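(* Let $s\in\{1,\dots,N\}$ and let $W:\mathbb R^{3\times3}\to\mathbb R\cup\{+\infty\}$ be given by $W=-\delta$ on $SO(3)$, $W=0$ on $\bigcup_{i=1}^NSO(3)U_i$, and $W=+\infty$ otherwise. Then $W$ is quasiconvex at $U_s$ in the interior; that is, $\langle\mu,W\rangle\ge W(U_s)$ for every homogeneous $W^{1,\infty}$ gradient Young measure $\mu$ with $\bar\mu=U_s$.
   Context: $U_1,\dots,U_N\in\mathbb R^{3\times3}$ are distinct positive definite symmetric matrices, different from the identity, that are symmetry related: $\{U_1,\dots,U_N\}=\{Q^TU_1Q:Q\in\mathcal P^{24}\}$, where $\mathcal P^{24}\subset SO(3)$ is the group of the 24 rotations mapping the unit cube to itself; $\delta>0$ is fixed. Let $B$ be the open unit ball in $\mathbb R^3$. A homogeneous $W^{1,\infty}$ gradient Young measure $\mu$ is a probability measure on $\mathbb R^{3\times3}$ for which there is a sequence $(y^k)$ bounded in $W^{1,\infty}(B,\mathbb R^3)$ with $f(Dy^k)\overset{*}{\rightharpoonup}\langle\mu,f\rangle:=\int f\,d\mu$ in $L^\infty(B)$ for every continuous $f:\mathbb R^{3\times3}\to\mathbb R$; $\bar\mu:=\int A\,d\mu(A)$. *)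

(* Defs.v *)
From HB Require Import structures.
From mathcomp Require Import all_boot all_order all_algebra.
From mathcomp Require Import all_classical all_reals all_analysis.

Set Implicit Arguments.
Unset Strict Implicit.
Unset Printing Implicit Defensive.

Import Order.TTheory GRing.Theory Num.Theory.
Import numFieldNormedType.Exports.

Local Open Scope classical_set_scope.
Local Open Scope ring_scope.

Section Matrices.
Variable R : realType.

Definition SO3 : set 'M[R]_3 := [set Q | Q^T *m Q = 1%:M /\ \det Q = 1].

Definition posdef_sym (A : 'M[R]_3) : Prop :=
  A^T = A /\ forall v : 'cV[R]_3, v != 0 -> 0 < (v^T *m A *m v) ord0 ord0.

(* Unit cube centred at the origin, so that rotations can preserve it. *)
Definition unit_cube : set 'cV[R]_3 :=
  [set v | forall i, `|v i ord0| <= 2^-1].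

Definition P24 : set 'M[R]_3 :=
  SO3 `&` [set Q | [set Q *m v | v in unit_cube] = unit_cube].

Definition well (A : 'M[R]_3) : set 'M[R]_3 := [set Q *m A | Q in SO3].

Definition Wnuc (delta : R) (n : nat) (U : 'I_n -> 'M[R]_3) (A : 'M[R]_3)
    : \bar R :=
  if A \in SO3 then (- delta)%:E
  else if A \in \bigcup_i well (U i) then 0%E
  else +oo%E.

End Matrices.

(* Points of the domain are triples, since the library has Lebesgue measure on
   R^3 only as a product measure; values and gradients are matrices. *)
Definition leb3 (R : realType) :=
  ((@lebesgue_measure R \x @lebesgue_measure R) \x @lebesgue_measure R)%E.

Definition borel (T : ptopologicalType) := g_sigma_algebraType (@open T).

Section Sobolev.
Variable R : realType.
Local Notation X := (R * R * R)%type.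
(* The same type, carrying the measurable structure on which leb3 is defined. *)
Local Notation mX := (measurableTypeR R * measurableTypeR R * measurableTypeR R)%type.

Definition B3 : set X := [set x | x.1.1 ^+ 2 + x.1.2 ^+ 2 + x.2 ^+ 2 < 1].

Definition e3 (j : 'I_3) : X :=
  ((j == 0%N :> nat)%:R, (j == 1%N :> nat)%:R, (j == 2%N :> nat)%:R).

Definition pderiv (j : 'I_3) (f : X -> R) : X -> R := fun x => 'D_(e3 j) f x.

Definition iter_pderiv (l : seq 'I_3) (f : X -> R) : X -> R := foldr pderiv f l.

Definition smooth (f : X -> R) : Prop :=
  forall l : seq 'I_3,
    continuous (iter_pderiv l f) /\
    forall j x, derivable (iter_pderiv l f) x (e3 j).

Definition test_function (f : X -> R) : Prop :=
  [/\ smooth f,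
      compact (closure [set x | f x != 0]) &
      closure [set x | f x != 0] `<=` B3].

(* G i j represents the weak derivative of y_i with respect to x_j. *)
Definition weak_gradient (y : X -> 'cV[R]_3) (G : X -> 'M[R]_3) : Prop :=
  forall phi, test_function phi -> forall i j,
    (\int[@leb3 R]_(x in B3) (y x i ord0 * pderiv j phi x)
     = - \int[@leb3 R]_(x in B3) (G x i j * phi x))%R.

(* y belongs to W^{1,oo}(B, R^3), with weak gradient (represented by) G and
   norm at most M; the norms on 'cV_3 and 'M_3 are the maximum norms. *)
Definition W1oo_le (M : R) (y : X -> 'cV[R]_3) (G : X -> 'M[R]_3) : Prop :=
  [/\ measurable_fun (B3 : set mX) (y : mX -> borel 'cV[R]_3),
      measurable_fun (B3 : set mX) (G : mX -> borel 'M[R]_3),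
      weak_gradient y G,
      {ae @leb3 R, forall x, B3 x -> `|y x| <= M} &
      {ae @leb3 R, forall x, B3 x -> `|G x| <= M}].

(* The convergence in the last clause is weak* convergence in L^oo(B), tested
   against g in L^1(B), of f(Dy^k) to the constant <mu, f>. *)
Definition homogeneous_GYM (mu : probability (borel 'M[R]_3) R) : Prop :=
  exists (y : nat -> X -> 'cV[R]_3) (G : nat -> X -> 'M[R]_3),
    (exists M : R, forall k, W1oo_le M (y k) (G k)) /\
    forall f : 'M[R]_3 -> R, continuous f ->
      mu.-integrable setT (EFin \o f) /\
      forall g : X -> R, (@leb3 R).-integrable B3 (EFin \o g) ->
        (fun k => \int[@leb3 R]_(x in B3) (f (G k x) * g x))%R @ \oo -->
        ((\int[mu]_A f A) * \int[@leb3 R]_(x in B3) g x)%R.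

Definition barycenter (mu : probability (borel 'M[R]_3) R) : 'M[R]_3 :=
  \matrix_(i, j) (\int[mu]_A (A : 'M[R]_3) i j)%R.

Definition quasiconvex_interior_at (W : 'M[R]_3 -> \bar R) (F : 'M[R]_3)
    : Prop :=
  forall mu : probability (borel 'M[R]_3) R,
    homogeneous_GYM mu -> barycenter mu = F ->
    (W F <= \int[mu]_A W A)%E.

End Sobolev.

(* Main.v *)
(* Let cof A be the cofactor matrix and L = U_s - cof U_s. Since cof (Q A R) =
   Q (cof A) R for rotations Q and R, the matrix A - cof A vanishes on SO(3) and
   has the constant Frobenius norm |L| on the wells; and L <> 0, because U = cof U
   forces U = 1 when U is positive definite. Hence the polyaffine function
   l(A) = (delta / |L|^2) (<A - cof A, L> - |L|^2) lies below W, and l(U_s) = 0.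
   The claim follows from <mu, l> = l(U_s), for which only the 2x2 minors of the
   gradient have to be weakly continuous.

   Weak continuity of the minors is compensated compactness made quantitative:
   mollify one factor at scale d. By curl-freeness, changing the scale from d to
   d' < d costs O(d) uniformly along the sequence; letting d' -> 0 for a fixed
   member recovers its minor, whereas for fixed d the mollified gradients
   converge pointwise. All test functions and kernels are tensor products of
   functions of one variable. *)

Require Import Defs.
From HB Require Import structures.
From mathcomp Require Import all_boot all_order all_algebra.
From mathcomp Require Import all_classical all_reals all_analysis.
From mathcomp Require Import measurable_realfun.
From mathcomp Require Import ring lra.

Set Implicit Arguments.
Unset Strict Implicit.
Unset Printing Implicit Defensive.

Import Order.TTheory GRing.Theory Num.Theory.
Import numFieldNormedType.Exports.

Local Open Scope classical_set_scope.
Local Open Scope ring_scope.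

(** * Smooth functions of one variable *)

Section Smooth1.
Variable R : realType.
Implicit Types (f g h : R -> R) (n : nat).

(** The maps are only bounded and measurable, and their gradients are known through test functions
    alone, so products cannot be differentiated directly. What works is the antisymmetric pairing of
    two gradients with one factor mollified: a derivative passes from [u] to the kernel, and
    curl-freeness of the other gradient cancels the terms for [(i, j)] and [(j, i)] in which it acts
    on the kernel. Only derivatives of a fixed cutoff survive. The ball is enlarged to the cube of
    side ]-1, 1[, with functions extended by zero, because integrals of tensor products factor
    there. The radii are nested: the cutoff lives in [-1/4, 1/4]^3 and kernels have width below 1/4,
    so all test functions are supported in [-1/2, 1/2]^3, which lies in the ball as 3/4 < 1.
    Mollifications have to converge only when tested against bounded functions. This follows by
    Dynkin induction from boxes, where a mollifier that is the derivative of a smooth step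
    integrates in closed form. The minors are identified by testing with the cutoff alone, whose
    integral is positive. *)

Fixpoint diffn n f : Prop :=
  if n is m.+1 then exists g, (forall x : R, is_derive x (1 : R) f (g x)) /\ diffn m g
  else True.

(** Each finite order carries its derivative as an explicit witness, so closure under sums, products
    and inverses is an induction on the order. *)
Definition smooth1 f := forall n, diffn n f.

Lemma is_derive_eqr f (x a b : R) : is_derive x 1 f a -> a = b -> is_derive x 1 f b.
Proof. by move=> + <-. Qed.

Lemma diffnS n f : diffn n.+1 f -> diffn n f.
Proof.
elim: n f => [//|n IH] f [g [fg gn]]; exists g; split => //; exact: IH.
Qed.

Lemma diffn_cst n c : diffn n (fun=> c).
Proof.
elim: n c => [//|n IH] c; exists (fun=> 0); split => // x; exact: is_derive_cst.
Qed.

Lemma diffnD n f g : diffn n f -> diffn n g -> diffn n (fun x => f x + g x).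
Proof.
elim: n f g => [//|n IH] f g [f' [ff' nf]] [g' [gg' ng]].
exists (fun x => f' x + g' x); split; last exact: IH.
by move=> x; apply: is_deriveD.
Qed.

Lemma diffnM n f g : diffn n f -> diffn n g -> diffn n (fun x => f x * g x).
Proof.
elim: n f g => [//|n IH] f g nf0 ng0.
have := diffnS nf0; have := diffnS ng0.
case: nf0 ng0 => [f' [ff' nf]] [g' [gg' ng]] ng1 nf1.
exists (fun x => f x * g' x + g x * f' x); split; last first.
  by apply: diffnD; apply: IH.
by move=> x; apply: is_deriveM.
Qed.

Lemma is_derive_affine (a b x : R) : is_derive x 1 (fun t => a * t + b) a.
Proof.
apply: (@is_derive_eqr (fun t => a * t + b) x (a *: 1 + 0)); last first.
  by rewrite addr0 /GRing.scale/= mulr1.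
Qed.

Lemma diffn_affine n f a b : diffn n f -> diffn n (fun x => f (a * x + b)).
Proof.
elim: n f => [//|n IH] f [g [fg ng]].
exists (fun x => g (a * x + b) * a); split; last first.
  by apply: diffnM; [exact: IH|exact: diffn_cst].
move=> x; have fx := fg (a * x + b); have ax := is_derive_affine a b x.
exact: (@is_derive1_comp _ f).
Qed.

Lemma diffnV n f : (forall x, f x != 0) -> diffn n f -> diffn n (fun x => (f x)^-1).
Proof.
move=> f0; elim: n => [//|n IH] nf0.
have := IH (diffnS nf0); case: nf0 => g [fg ng] nV.
exists (fun x => -1 * (((f x)^-1 * (f x)^-1) * g x)); split; last first.
  apply: diffnM; first exact: diffn_cst.
  by apply: diffnM => //; exact: diffnM.
move=> x; apply: is_derive_eqr (@is_deriveV R f x (g x) 1 (f0 x) (fg x)) _.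
by rewrite mulN1r /GRing.scale/= expr2 invfM mulNr.
Qed.

Lemma smooth1_cst c : smooth1 (fun=> c). Proof. by move=> n; exact: diffn_cst. Qed.

Lemma smooth1D f g : smooth1 f -> smooth1 g -> smooth1 (fun x => f x + g x).
Proof. by move=> sf sg n; apply: diffnD. Qed.

Lemma smooth1M f g : smooth1 f -> smooth1 g -> smooth1 (fun x => f x * g x).
Proof. by move=> sf sg n; apply: diffnM. Qed.

Lemma smooth1_affine f a b : smooth1 f -> smooth1 (fun x => f (a * x + b)).
Proof. by move=> sf n; apply: diffn_affine. Qed.

Lemma smooth1V f : (forall x, f x != 0) -> smooth1 f -> smooth1 (fun x => (f x)^-1).
Proof. by move=> f0 sf n; apply: diffnV. Qed.

Lemma smooth1_is_derive f (x : R) : smooth1 f -> is_derive x 1 f (derive1 f x).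
Proof. by move=> /(_ 1%N)[g [fg _]]; rewrite derive1E; apply: derivableP. Qed.

Lemma derive1_eq f g : (forall x : R, is_derive x 1 f (g x)) -> derive1 f = g.
Proof. by move=> fg; apply/funext => x; rewrite derive1E; apply: derive_val. Qed.

Lemma smooth1_derive1 f : smooth1 f -> smooth1 (derive1 f).
Proof. by move=> sf n; have [g [/derive1_eq -> gn]] := sf n.+1. Qed.

Lemma smooth1_continuous f : smooth1 f -> continuous f.
Proof.
move=> sf x; apply: differentiable_continuous; apply/derivable1_diffP.
by have [] := smooth1_is_derive x sf.
Qed.

(* [t^-n exp(-1/t)]: this family is stable under differentiation. *)
Definition flat n (t : R) := if 0 < t then t ^- n * expR (- t^-1) else 0.

(** For [t > 0] this is the Taylor bound exp(1/t) >= t^-(n+2) / (n+2)!. The index n+2 is chosen to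
    leave a factor t^2, which forces a zero derivative at the origin. *)
Lemma flat_le n t : `|flat n t| <= (n.+2)`!%:R * t ^+ 2.
Proof.
rewrite /flat; case: ifPn => t0; last first.
  by rewrite normr0 mulr_ge0// sqr_ge0.
have E : 1 + t^-1 ^+ n.+2 / (n.+2)`!%:R <= expR t^-1.
  by apply: expR_ge1Dxn; rewrite invr_ge0 ltW.
rewrite ger0_norm; last by rewrite mulr_ge0 ?expR_ge0// invr_ge0 exprn_ge0// ltW.
rewrite expRN -invfM -[leRHS]invrK lef_pV2 ?posrE; last 2 first.
- by rewrite mulr_gt0 ?expR_gt0// exprn_gt0.
- by rewrite invr_gt0 mulr_gt0 ?exprn_gt0// ltr0n fact_gt0.
apply: (@le_trans _ _ (t ^+ n * (t^-1 ^+ n.+2 / n.+2`!%:R))); last first.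
  apply: ler_wpM2l; first by rewrite exprn_ge0// ltW.
  by apply: le_trans E; rewrite lerDr.
have tn0 : t != 0 by rewrite gt_eqF.
have F0 : (n.+2)`!%:R != 0 :> R by rewrite pnatr_eq0 -lt0n fact_gt0.
rewrite [X in _ <= X](_ : _ = ((n.+2)`!%:R * t ^+ 2)^-1)//.
move: F0; move: ((n.+2)`!%:R) => F F0; rewrite exprVn !exprS.
by field; rewrite F0 tn0 expf_neq0.
Qed.

Lemma is_derive0_sqr f C : f 0 = 0 -> (forall t, `|f t| <= C * t ^+ 2) ->
  is_derive (0 : R) (1 : R) f 0.
Proof.
move=> f0 fC.
have H : h^-1 *: ((f \o shift 0) (h *: 1) - f 0) @[h --> 0^'] --> 0.
  have C0 : 0 <= C.
    by have := fC 1; rewrite expr1n mulr1; exact: le_trans.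
  apply/cvgr0Pnorm_le => e e0.
  have Ce : 0 < e / (C + 1) by rewrite divr_gt0// ltr_wpDl.
  near=> h.
  have h0 : h != 0 by near: h; exact: nbhs_dnbhs_neq.
  rewrite /= addr0 f0 subr0 /GRing.scale/= mulr1 normrM normfV.
  rewrite ler_pdivrMl ?normr_gt0//; apply: le_trans (fC h) _.
  rewrite -(real_normK (num_real h)) expr2 mulrCA ler_pM2l ?normr_gt0//.
  have hC : `|h| <= e / (C + 1).
    near: h; exact: dnbhs0_le.
  apply: (@le_trans _ _ ((C + 1) * (e / (C + 1)))).
    by rewrite ler_pM// lerDl.
  by rewrite mulrCA divff ?mulr1// gt_eqF// ltr_wpDl.
apply: DeriveDef; first by apply/cvg_ex; exists 0.
exact/cvg_lim.
Unshelve. all: by end_near. Qed.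

(** For [t > 0] this is the product rule, for [t < 0] the function is locally zero, and at 0 the
    quadratic bound [flat_le] joins the two sides. *)
Lemma is_derive_flat n (t : R) :
  is_derive t 1 (flat n) (- n%:R * flat n.+1 t + flat n.+2 t).
Proof.
have [t0|t0|->] := ltrgt0P t.
- apply: (@near_eq_is_derive R R R (fun t => t ^- n * expR (- t^-1))).
    near=> s; rewrite /flat ifT//; near: s; exact: lt_nbhsr.
  have tn0 : t != 0 by rewrite gt_eqF.
  rewrite /flat t0.
  have dV := @is_deriveV R id t 1 1 tn0 (is_derive_id t (1 : R)).
  have dX : is_derive t (1 : R) (fun t => t ^+ n) (n%:R * t ^+ n.-1).
    rewrite (_ : (fun t => t ^+ n) = (id : R -> R) ^+ n); last first.
      by apply/funext => s; rewrite fctE.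
    apply: is_derive_eqr (is_deriveX n (is_derive_id t (1 : R))) _.
    by rewrite /GRing.scale/= mulr1.
  have dXV := @is_deriveV R _ t _ 1 (expf_neq0 n tn0) dX.
  have dE := @is_derive1_comp R expR _ t _ _ (is_derive_expR (- t^-1)) (is_deriveN dV).
  apply: is_derive_eqr (is_deriveM dXV dE) _.
  clear dV dX dXV dE; rewrite /GRing.scale/= !mulr1; case: n => [|n].
    by rewrite !exprS expr0; field.
  by rewrite /= !exprS; field; rewrite tn0 expf_neq0.
- apply: (@near_eq_is_derive R R R (fun=> 0)).
    near=> s; rewrite /flat ifN// -leNgt ltW//; near: s; exact: lt_nbhsl.
  by rewrite /flat ltNge (ltW t0)/= mulr0 addr0; exact: is_derive_cst.
- rewrite /flat ltxx mulr0 addr0.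
  apply: (@is_derive0_sqr _ (n.+2)`!%:R) => [|t'].
    by rewrite /flat ltxx.
  exact: flat_le.
Unshelve. all: by end_near. Qed.

Lemma diffn_flat m n : diffn m (flat n).
Proof.
elim: m n => [//|m IH] n; exists (fun t => - n%:R * flat n.+1 t + flat n.+2 t).
split; first exact: is_derive_flat.
by apply: diffnD => //; apply: diffnM => //; exact: diffn_cst.
Qed.

(** The usual smooth transition from 0 (for [t <= 0]) to 1 (for [t >= 1]). The form [- 1 * t + 1]
    matches [smooth1_affine]. *)
Definition step (t : R) : R := flat 0 t / (flat 0 t + flat 0 (- 1 * t + 1)).

Lemma flat0_ge0 t : 0 <= flat 0 t.
Proof.
by rewrite /flat; case: ifP => // t0; rewrite mulr_ge0 ?expR_ge0// expr0 invr1.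
Qed.

Lemma flat0_gt0 t : 0 < t -> 0 < flat 0 t.
Proof. by rewrite /flat => ->; rewrite mulr_gt0 ?expR_gt0// expr0 invr1. Qed.

Lemma flat0_le0 t : t <= 0 -> flat 0 t = 0.
Proof. by rewrite /flat ltNge => ->. Qed.

Lemma step_den_gt0 t : 0 < flat 0 t + flat 0 (- 1 * t + 1).
Proof.
have [t0|t0] := ltP 0 t; first by rewrite ltr_pwDl ?flat0_gt0 ?flat0_ge0.
by rewrite ltr_wpDl ?flat0_ge0// flat0_gt0//; lra.
Qed.

Lemma smooth1_step : smooth1 step.
Proof.
have sf n : smooth1 (flat n) by move=> m; exact: diffn_flat.
apply: smooth1M => //; apply: smooth1V.
  by move=> x; rewrite gt_eqF// step_den_gt0.
by apply: smooth1D => //; exact: smooth1_affine.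
Qed.

Lemma step_le0 t : t <= 0 -> step t = 0.
Proof. by move=> t0; rewrite /step (flat0_le0 t0) mul0r. Qed.

Lemma step_ge1 t : 1 <= t -> step t = 1.
Proof.
move=> t1; rewrite /step (@flat0_le0 (_ + _)); last lra.
by rewrite addr0 divff// gt_eqF// flat0_gt0//; lra.
Qed.

Lemma step_ge0 t : 0 <= step t.
Proof. by rewrite divr_ge0 ?flat0_ge0// ltW// step_den_gt0. Qed.

Lemma step_le1 t : step t <= 1.
Proof. by rewrite ler_pdivrMr ?step_den_gt0// mul1r lerDl flat0_ge0. Qed.

(** Since [step >= 0], every [t <= 0] is a minimum, so the derivative vanishes there, the endpoint 0
    included. *)
Lemma derive1_step_le0 (t : R) : t <= 0 -> derive1 step t = 0.
Proof.
move=> t0; have H : is_derive t (1 : R) step 0.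
  apply: (@derive1_at_min _ step (t - 1) (t + 1)).
  - lra.
  - by move=> s _; have [] := smooth1_is_derive s smooth1_step.
  - by rewrite in_itv/=; apply/andP; split; lra.
  - by move=> s _; rewrite (step_le0 t0) step_ge0.
by rewrite derive1E; apply: derive_val.
Qed.

Lemma derive1_step_ge1 (t : R) : 1 <= t -> derive1 step t = 0.
Proof.
move=> t0; have H : is_derive t (1 : R) step 0.
  apply: (@derive1_at_max _ step (t - 1) (t + 1)).
  - lra.
  - by move=> s _; have [] := smooth1_is_derive s smooth1_step.
  - by rewrite in_itv/=; apply/andP; split; lra.
  - by move=> s _; rewrite (step_ge1 t0) step_le1.
by rewrite derive1E; apply: derive_val.
Qed.

Lemma derive1_step_bounded : exists S : R, 0 < S /\ forall t, `|derive1 step t| <= S.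
Proof.
have cs : {within `[(0 : R), 1], continuous (fun t => `|derive1 step t|)}.
  apply: continuous_subspaceT => t; apply: continuous_comp.
    exact/smooth1_continuous/smooth1_derive1/smooth1_step.
  exact: norm_continuous.
have [c _ cmax] := EVT_max ler01 cs.
exists (`|derive1 step c| + 1); split; first by rewrite ltr_wpDl.
move=> t; have [t0|t0] := leP t 0; first by rewrite derive1_step_le0// normr0 addr_ge0.
have [t1|t1] := leP 1 t; first by rewrite derive1_step_ge1// normr0 addr_ge0.
apply: (@le_trans _ _ `|derive1 step c|); last by rewrite lerDl.
by apply: cmax; rewrite in_itv/= !ltW.
Qed.

Definition dilstep (d t : R) : R := step (d^-1 * t + 0).
(** A one-sided mollifier supported in [0, d]. Being defined as a derivative, it comes with the
    primitive [dilstep d], which rises from 0 to 1. *)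
Definition mollif (d : R) : R -> R := derive1 (dilstep d).

Lemma smooth1_dilstep d : smooth1 (dilstep d).
Proof. exact/smooth1_affine/smooth1_step. Qed.

Lemma smooth1_mollif d : smooth1 (mollif d).
Proof. exact/smooth1_derive1/smooth1_dilstep. Qed.

Lemma mollifE d t : mollif d t = derive1 step (d^-1 * t + 0) * d^-1.
Proof.
have h (x : R) : is_derive x (1 : R) (dilstep d) (derive1 step (d^-1 * x + 0) * d^-1).
  have := smooth1_is_derive (d^-1 * x + 0) smooth1_step.
  have := is_derive_affine d^-1 0 x => h1 h2.
  exact: (@is_derive1_comp _ step).
by rewrite /mollif (derive1_eq h).
Qed.

Lemma dilstep_le0 d t : 0 < d -> t <= 0 -> dilstep d t = 0.
Proof. by move=> d0 t0; rewrite /dilstep step_le0// addr0 pmulr_rle0// invr_gt0. Qed.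

Lemma dilstep_ge1 d t : 0 < d -> d <= t -> dilstep d t = 1.
Proof. by move=> d0 t0; rewrite /dilstep step_ge1// addr0 ler_pdivlMl// mulr1. Qed.

Lemma dilstep_ge0 d t : 0 <= dilstep d t. Proof. exact: step_ge0. Qed.

Lemma dilstep_le1 d t : dilstep d t <= 1. Proof. exact: step_le1. Qed.

Lemma mollif_le0 d t : 0 < d -> t <= 0 -> mollif d t = 0.
Proof.
move=> d0 t0; rewrite mollifE derive1_step_le0 ?mul0r//.
by rewrite addr0 pmulr_rle0// invr_gt0.
Qed.

Lemma mollif_ge d t : 0 < d -> d <= t -> mollif d t = 0.
Proof.
move=> d0 t0; rewrite mollifE derive1_step_ge1 ?mul0r//.
by rewrite addr0 ler_pdivlMl// mulr1.
Qed.

(** The constant is independent of [d]: height [S / d] times width [d] bounds the mass by [S] at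
    every scale. *)
Lemma mollif_bounded : exists S : R, 0 < S /\ forall d t, 0 < d -> `|mollif d t| <= S / d.
Proof.
have [S [S0 hS]] := derive1_step_bounded; exists S; split => // d t d0.
by rewrite mollifE normrM (gtr0_norm (_ : 0 < d^-1)) ?invr_gt0// ler_wpM2r// invr_ge0 ltW.
Qed.

(* The step is one-sided, so the limit is the indicator of [0 < t] at every [t]:
   mollified rays converge everywhere, with no exceptional null set. *)
Lemma dilstep_cvg (d : nat -> R) t : (forall n, 0 < d n) -> d @ \oo --> 0 ->
  (fun n => dilstep (d n) t) @ \oo --> ((0 < t)%R%:R : R).
Proof.
move=> d0 dc; have [t0|t0] := ltP 0 t; last first.
  rewrite (_ : (fun n => _) = fun=> 0); first exact: cvg_cst.
  by apply/funext => n; rewrite dilstep_le0.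
apply: cvg_near_cst; near=> n; apply: dilstep_ge1 => //.
near: n; exact: (cvgr_le 0 dc).
Unshelve. all: by end_near. Qed.

(** The coefficients make it 1 for |t| <= 1/8 and 0 for |t| >= 1/4. The radius 1/4 leaves room for
    kernels of width below 1/4 inside [-1/2, 1/2]. *)
Definition cutoff (t : R) : R := step (8 * t + 2) * step (- 8 * t + 2).

Lemma smooth1_cutoff : smooth1 cutoff.
Proof. by apply: smooth1M; apply: smooth1_affine; exact: smooth1_step. Qed.

Lemma cutoff_ge0 t : 0 <= cutoff t.
Proof. by rewrite mulr_ge0 ?step_ge0. Qed.

Lemma cutoff_eq0 t : 4^-1 <= `|t| -> cutoff t = 0.
Proof.
rewrite /cutoff ler_normr => /orP[t1|t1].
  by rewrite (@step_le0 (- 8 * t + 2)) ?mulr0//; lra.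
by rewrite (@step_le0 (8 * t + 2)) ?mul0r//; lra.
Qed.

Lemma cutoff_eq1 t : `|t| <= 8^-1 -> cutoff t = 1.
Proof. by rewrite ler_norml => /andP[t1 t2]; rewrite /cutoff !step_ge1 ?mulr1//; lra. Qed.

Lemma derive1_cutoff_eq0 (t : R) : 4^-1 <= `|t| -> derive1 cutoff t = 0.
Proof.
move=> t0; have H : is_derive t (1 : R) cutoff 0.
  apply: (@derive1_at_min _ cutoff (t - 1) (t + 1)).
  - lra.
  - by move=> s _; have [] := smooth1_is_derive s smooth1_cutoff.
  - by rewrite in_itv/=; apply/andP; split; lra.
  - by move=> s _; rewrite (cutoff_eq0 t0) cutoff_ge0.
by rewrite derive1E; apply: derive_val.
Qed.

End Smooth1.

(** * Tensor products as test functions *)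

Section Tensor.
Variable R : realType.
Local Notation X := (R * R * R)%type.
Implicit Types (a : 'I_3 -> R -> R) (j : 'I_3).

Definition i30 : 'I_3 := @Ordinal 3 0 isT.
Definition i31 : 'I_3 := @Ordinal 3 1 isT.
Definition i32 : 'I_3 := @Ordinal 3 2 isT.

Lemma ord3P j : [\/ j = i30, j = i31 | j = i32].
Proof.
by case: j => [[|[|[|//]]] p]; [constructor 1|constructor 2|constructor 3]; apply: val_inj.
Qed.

Definition tens a (x : X) : R := a i30 x.1.1 * a i31 x.1.2 * a i32 x.2.

Definition dtens j a : 'I_3 -> R -> R :=
  fun i => if i == j then derive1 (a i) else a i.

(** The two difference quotients are the same function of [h], so a directional derivative reduces
    to one variable without differentiability of [f] on the product. *)
Lemma is_derive_line (f : X -> R) (g : R -> R) (x v : X) (y df : R) :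
  (forall h : R, f (h *: v + x) = g (h + y)) -> is_derive y (1 : R) g df ->
  is_derive x v f df.
Proof.
move=> fg [dg <-].
have fx : f x = g y by have := fg 0; rewrite scale0r !add0r.
have E : (fun h : R => h^-1 *: ((f \o shift x) (h *: v) - f x)) =
         (fun h : R => h^-1 *: ((g \o shift y) (h *: (1 : R)) - g y)).
  by apply/funext => h; rewrite /= fg fx /GRing.scale/= mulr1.
split; first by rewrite /derivable E.
by rewrite /derive E.
Qed.

Lemma is_derive_tens a j (x : X) : (forall i, smooth1 (a i)) ->
  is_derive x (e3 R j) (tens a) (tens (dtens j a) x).
Proof.
move=> sa; have da i (t : R) := smooth1_is_derive t (sa i).
have dM (c t : R) i : is_derive t (1 : R) (fun t => c * a i t) (c * derive1 (a i) t).
  exact: is_deriveZ.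
rewrite /tens /dtens; have [->|->|->] := ord3P j.
- apply: (@is_derive_line _ (fun t => a i31 x.1.2 * a i32 x.2 * a i30 t) x _ x.1.1).
    by move=> h; rewrite /= !scaler0 !add0r [h *: _]mulr1; ring.
  by apply: is_derive_eqr (dM _ _ _) _; rewrite /=; ring.
- apply: (@is_derive_line _ (fun t => a i30 x.1.1 * a i32 x.2 * a i31 t) x _ x.1.2).
    by move=> h; rewrite /= !scaler0 !add0r [h *: _]mulr1; ring.
  by apply: is_derive_eqr (dM _ _ _) _; rewrite /=; ring.
- apply: (@is_derive_line _ (fun t => a i30 x.1.1 * a i31 x.1.2 * a i32 t) x _ x.2).
    by move=> h; rewrite /= !scaler0 !add0r [h *: _]mulr1; ring.
Qed.

Lemma pderiv_tens a j : (forall i, smooth1 (a i)) ->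
  pderiv j (tens a) = tens (dtens j a).
Proof.
by move=> sa; apply/funext => x; have := is_derive_tens j x sa; move=> [_ <-].
Qed.

Lemma smooth1_dtens a j : (forall i, smooth1 (a i)) ->
  forall i, smooth1 (dtens j a i).
Proof. by move=> sa i; rewrite /dtens; case: ifP => // _; exact: smooth1_derive1. Qed.

Lemma continuous_tens a : (forall i, continuous (a i)) -> continuous (tens a).
Proof.
move=> ca x; rewrite /tens; apply: cvgM; first apply: cvgM.
- by apply: (continuous_comp (g := a i30) (f := fun x : X => x.1.1)); [|exact: ca];
    apply: continuous_comp; exact: cvg_fst.
- by apply: (continuous_comp (g := a i31) (f := fun x : X => x.1.2)); [|exact: ca];
    apply: continuous_comp; [exact: cvg_fst|exact: cvg_snd].
- by apply: (continuous_comp (g := a i32) (f := fun x : X => x.2)); [|exact: ca];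
    exact: cvg_snd.
Qed.

(** Differentiation replaces one factor of a tensor product and so stays within the class; every
    iterated partial derivative is again some [tens b]. *)
Lemma smooth_tens a : (forall i, smooth1 (a i)) -> smooth (tens a).
Proof.
move=> sa l.
have [b [sb ->]] : exists b, (forall i, smooth1 (b i)) /\ iter_pderiv l (tens a) = tens b.
  elim: l => [|j l [b [sb e]]]; first by exists a.
  exists (dtens j b); split; first exact: smooth1_dtens.
  by rewrite /= e pderiv_tens.
split; first by apply: continuous_tens => i; exact: smooth1_continuous.
by move=> j x; have [] := is_derive_tens j x sb.
Qed.

(** The support lies in [-1/2, 1/2]^3, where the squared norm is at most 3/4 < 1. *)
Lemma test_function_tens a : (forall i, smooth1 (a i)) ->
  (forall i t, 2^-1 <= `|t| -> a i t = 0) -> test_function (tens a).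
Proof.
move=> sa a0.
pose I := `[- 2^-1, 2^-1 : R]%classic.
have cI : compact I by exact: segment_compact.
pose K : set X := (I `*` I) `*` I.
have cK : compact K by apply: compact_setX => //; exact: compact_setX.
have clK : closed K by apply: compact_closed => //; exact: norm_hausdorff.
have AK : closure [set x | tens a x != 0] `<=` K.
  rewrite [X in _ `<=` X](closure_id K).1//; apply: closureS => x /= ax.
  have h i t : a i t != 0 -> I t.
    move=> at0; rewrite /I/= in_itv/= -ler_norml.
    by rewrite leNgt; apply: contra at0 => /ltW/(a0 i) ->.
  move: ax; rewrite /tens !mulf_eq0 !negb_or => /andP[/andP[h1 h2] h3].
  by split; [split|]; [exact: h h1|exact: h h2|exact: h h3].
split; first exact: smooth_tens.
- by apply: (subclosed_compact _ cK AK); exact: closed_closure.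
- apply: (subset_trans AK) => x [[x1 x2] x3]; rewrite /B3/=.
  have h (t : R) : I t -> t ^+ 2 <= 4^-1.
    rewrite /I/= in_itv/= -ler_norml => ht.
    rewrite -(real_normK (num_real t)); apply: (@le_trans _ _ (2^-1 ^+ 2)).
      by rewrite lerXn2r// nnegrE.
    lra.
  move: (h _ x1) (h _ x2) (h _ x3); lra.
Qed.

Lemma tens_dtensC a i j : tens (dtens i (dtens j a)) = tens (dtens j (dtens i a)).
Proof.
apply/funext => x; congr (_ * _ * _);
  by rewrite /dtens; case: (_ == i); case: (_ == j).
Qed.

End Tensor.

(** * Bounded measurable functions *)

Section BoundedMeasurable.
Context d (T : measurableType d) (R : realType).
Implicit Types f g : T -> R.

(** Bounds and measurability are required globally, so that sections, compositions and products
    inherit them and the side conditions of Fubini and dominated convergence hold on every set of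
    finite measure. *)
Definition bmf f := measurable_fun setT f /\ exists M, forall x, `|f x| <= M.

Lemma bmf_cst c : bmf (fun=> c).
Proof. by split; [exact: measurable_cst|exists `|c|]. Qed.

Lemma bmfD f g : bmf f -> bmf g -> bmf (fun x => f x + g x).
Proof.
move=> [mf [M hM]] [mg [N hN]]; split; first exact: measurable_funD.
by exists (M + N) => x; apply: le_trans (ler_normD _ _) _; exact: lerD.
Qed.

Lemma bmfM f g : bmf f -> bmf g -> bmf (fun x => f x * g x).
Proof.
move=> [mf [M hM]] [mg [N hN]]; split; first exact: measurable_funM.
by exists (M * N) => x; rewrite normrM; apply: ler_pM.
Qed.

Lemma bmfZ c f : bmf f -> bmf (fun x => c * f x).
Proof. exact: bmfM (bmf_cst c). Qed.

Lemma bmfN f : bmf f -> bmf (fun x => - f x).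
Proof.
by move=> /(bmfZ (-1)); congr bmf; apply/funext => x; rewrite mulN1r.
Qed.

Lemma bmfB f g : bmf f -> bmf g -> bmf (fun x => f x - g x).
Proof. by move=> bf /bmfN; exact: bmfD. Qed.

Lemma bmf_norm f : bmf f -> bmf (fun x => `|f x|).
Proof.
move=> [mf [M hM]]; split; first exact: measurableT_comp.
by exists M => x; rewrite normr_id.
Qed.

Lemma bmf_indic (A : set T) : measurable A -> bmf (\1_A).
Proof.
move=> mA; split; first exact: measurable_indic.
by exists 1 => x; rewrite indicE ger0_norm// lern1; case: (_ \in _).
Qed.

Variables (mu : {measure set T -> \bar R}) (D : set T).
Hypotheses (mD : measurable D) (fD : (mu D < +oo)%E).

Local Notation J := (Rintegral mu D).

Lemma bmf_integrable f : bmf f -> mu.-integrable D (EFin \o f).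
Proof.
move=> [mf [M hM]]; apply: measurable_bounded_integrable => //.
  exact: measurable_funTS.
exists M; split => //=.
by move=> N MN x _; apply: le_trans (hM x) (ltW MN).
Qed.

Lemma bmf_RintegralD f g : bmf f -> bmf g -> J (fun x => f x + g x) = J f + J g.
Proof. by move=> bf bg; rewrite RintegralD//; exact: bmf_integrable. Qed.

Lemma bmf_RintegralZ c f : bmf f -> J (fun x => c * f x) = c * J f.
Proof. by move=> bf; rewrite RintegralZl//; exact: bmf_integrable. Qed.

Lemma bmf_RintegralN f : bmf f -> J (fun x => - f x) = - J f.
Proof.
move=> bf; rewrite -mulN1r -bmf_RintegralZ//; congr Rintegral.
by apply/funext => x; rewrite mulN1r.
Qed.

Lemma bmf_RintegralB f g : bmf f -> bmf g -> J (fun x => f x - g x) = J f - J g.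
Proof. by move=> bf bg; rewrite RintegralB//; exact: bmf_integrable. Qed.

Lemma bmf_le_Rintegral f g : bmf f -> bmf g ->
  (forall x, D x -> f x <= g x) -> J f <= J g.
Proof. by move=> bf bg fg; apply: le_Rintegral => //; exact: bmf_integrable. Qed.

Lemma bmf_le_normr_Rintegral f g : bmf f -> bmf g ->
  (forall x, D x -> `|f x| <= g x) -> `|J f| <= J g.
Proof.
move=> bf bg fg; apply: le_trans (le_normr_Rintegral mD (bmf_integrable bf)) _.
exact: (bmf_le_Rintegral (bmf_norm bf)).
Qed.

Lemma bmf_Rintegral_bound f c : bmf f ->
  (forall x, D x -> `|f x| <= c) -> `|J f| <= c * fine (mu D).
Proof.
move=> bf fc; rewrite -(Rintegral_cst _ mD).
exact: bmf_le_normr_Rintegral (bmf_cst c) _.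
Qed.

Lemma bmf_dominated (f_ : nat -> T -> R) f (c : R) :
  (forall n, bmf (f_ n)) -> bmf f ->
  (forall n x, D x -> `|f_ n x| <= c) ->
  (forall x, D x -> (fun n => f_ n x) @ \oo --> f x) ->
  (fun n => J (f_ n)) @ \oo --> J f.
Proof.
move=> bf_ bf fc ff.
have [||||| _ _ H] := @dominated_convergence _ _ _ mu D mD
  (fun n x => (f_ n x)%:E) (EFin \o f) (fun=> c%:E).
- by move=> n; exact: measurable_int (bmf_integrable (bf_ n)).
- exact: measurable_int (bmf_integrable bf).
- apply: aeW => x Dx; apply: cvg_EFin; last exact: ff.
  exact: nearW.
- exact: bmf_integrable (bmf_cst c).
- by apply: aeW => x n Dx; rewrite lee_fin fc.
apply: fine_cvg; rewrite fineK//.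
exact: integrable_fin_num (bmf_integrable bf).
Qed.

End BoundedMeasurable.

(** * Product measures and Fubini for bounded functions *)

Section SigmaFiniteProduct.
Context d1 d2 (T1 : measurableType d1) (T2 : measurableType d2) (R : realType).
Variables (m1 : {sigma_finite_measure set T1 -> \bar R})
  (m2 : {sigma_finite_measure set T2 -> \bar R}).

(* [m1 \x m2] itself carries the canonical structure of a product of
   subprobabilities, which hides its sigma-finiteness. *)
Definition sfprod : set (T1 * T2) -> \bar R := (m1 \x m2)%E.

HB.instance Definition _ := Measure.copy sfprod (m1 \x m2)%E.

Let sfprod_sigma_finite : sigma_finite setT sfprod.
Proof.
have /sigma_finiteP[F [TF ndF Foo]] := sigma_finiteT m1.
have /sigma_finiteP[G [TG ndG Goo]] := sigma_finiteT m2.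
exists (fun n => F n `*` G n) => [|k].
  apply/seteqP; split=> // -[x y] _.
  have [n _ Fx] : (\bigcup_i F i) x by rewrite -TF.
  have [m _ Gy] : (\bigcup_i G i) y by rewrite -TG.
  exists (maxn n m) => //; split => /=.
  - by have /subsetPset := ndF _ _ (leq_maxl n m); apply.
  - by have /subsetPset := ndG _ _ (leq_maxr n m); apply.
have [mF fF] := Foo k; have [mG fG] := Goo k; split; first exact: measurableX.
by rewrite /sfprod product_measure1E// lte_mul_pinfty// ge0_fin_numE.
Qed.

HB.instance Definition _ := Measure_isSigmaFinite.Build _ _ _ sfprod sfprod_sigma_finite.

End SigmaFiniteProduct.

Section Swap.
Context d1 d2 (T1 : measurableType d1) (T2 : measurableType d2) (R : realType).
Variables (m1 : {sigma_finite_measure set T1 -> \bar R})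
  (m2 : {sigma_finite_measure set T2 -> \bar R}) (D1 : set T1) (D2 : set T2).
Hypotheses (mD1 : measurable D1) (mD2 : measurable D2)
  (fD1 : (m1 D1 < +oo)%E) (fD2 : (m2 D2 < +oo)%E).
Variable F : T1 * T2 -> R.
Hypothesis bF : bmf F.

Lemma bmf_pair1 x : bmf (fun y => F (x, y)).
Proof.
case: bF => mF [M hM]; split; last by exists M => y.
exact: measurableT_comp mF (pair1_measurable x).
Qed.

Lemma bmf_pair2 y : bmf (fun x => F (x, y)).
Proof.
case: bF => mF [M hM]; split; last by exists M => x.
exact: measurableT_comp mF (pair2_measurable y).
Qed.

(** Tonelli gives measurability for nonnegative integrands on the whole space. Hence [F] is shifted
    by its bound [M] and cut off by the indicator of [D2], and the known integral of [M] is
    subtracted afterwards. *)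
Lemma bmf_Rintegral2 : bmf (fun x => Rintegral m2 D2 (fun y => F (x, y))).
Proof.
case: (bF) => mF [M hM]; split; last first.
  by exists (M * fine (m2 D2)) => x; apply: bmf_Rintegral_bound => //; exact: bmf_pair1.
pose G := fun z : T1 * T2 => (((F z + M) * \1_D2 z.2)%:E)%E.
have mG : measurable_fun setT G.
  apply/measurable_EFinP; apply: measurable_funM.
    by apply: measurable_funD => //; exact: measurable_cst.
  by apply: measurableT_comp => //; exact: measurable_indic.
have G0 z : (0 <= G z)%E.
  rewrite lee_fin mulr_ge0// ?indicE ?ler0n//.
  by rewrite -lerBlDr sub0r; have := hM z; rewrite ler_norml => /andP[].
have mI := @measurable_fun_fubini_tonelli_F _ _ _ _ _ m2 G mG G0.
rewrite (_ : (fun x => _) = fun x => fine (fubini_F m2 G x) - M * fine (m2 D2)).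
  apply: measurable_funB; last exact: measurable_cst.
  by apply: measurableT_comp => //; exact: fine_measurable.
apply/funext => x.
have -> : fine (fubini_F m2 G x) = Rintegral m2 D2 (fun y => F (x, y) + M).
  rewrite /fubini_F /Rintegral /G [in RHS]integral_mkcond; congr fine.
  apply: eq_integral => y _ /=; rewrite patchE indicE.
  by case: (y \in D2); rewrite ?mulr1 ?mulr0.
rewrite bmf_RintegralD//; last 2 first.
- exact: bmf_pair1.
- exact: bmf_cst.
by rewrite Rintegral_cst// addrK.
Qed.

Lemma bmf_Rintegral1 : bmf (fun y => Rintegral m1 D1 (fun x => F (x, y))).
Proof.
case: (bF) => mF [M hM]; split; last first.
  by exists (M * fine (m1 D1)) => x; apply: bmf_Rintegral_bound => //; exact: bmf_pair2.
pose G := fun z : T1 * T2 => (((F z + M) * \1_D1 z.1)%:E)%E.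
have mG : measurable_fun setT G.
  apply/measurable_EFinP; apply: measurable_funM.
    by apply: measurable_funD => //; exact: measurable_cst.
  by apply: measurableT_comp => //; exact: measurable_indic.
have G0 z : (0 <= G z)%E.
  rewrite lee_fin mulr_ge0// ?indicE ?ler0n//.
  by rewrite -lerBlDr sub0r; have := hM z; rewrite ler_norml => /andP[].
have mI := @measurable_fun_fubini_tonelli_G _ _ _ _ _ m1 G mG G0.
rewrite (_ : (fun y => _) = fun y => fine (fubini_G m1 G y) - M * fine (m1 D1)).
  apply: measurable_funB; last exact: measurable_cst.
  by apply: measurableT_comp => //; exact: fine_measurable.
apply/funext => y.
have -> : fine (fubini_G m1 G y) = Rintegral m1 D1 (fun x => F (x, y) + M).
  rewrite /fubini_G /Rintegral /G [in RHS]integral_mkcond; congr fine.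
  apply: eq_integral => x _ /=; rewrite patchE indicE.
  by case: (x \in D1); rewrite ?mulr1 ?mulr0.
rewrite bmf_RintegralD//; last 2 first.
- exact: bmf_pair2.
- exact: bmf_cst.
by rewrite Rintegral_cst// addrK.
Qed.

Lemma sfprodX_lty : (sfprod m1 m2 (D1 `*` D2) < +oo)%E.
Proof.
by rewrite /sfprod product_measure1E// lte_mul_pinfty// ge0_fin_numE.
Qed.

Let F1 : (m1 \x m2)%E.-integrable setT ((EFin \o F) \_ (D1 `*` D2)).
Proof.
rewrite -integrable_mkcond//; last exact: measurableX.
by apply: bmf_integrable => //; [exact: measurableX|exact: sfprodX_lty].
Qed.

(** Extension by zero off the rectangle turns the restricted iterated integral into one over the
    whole space; for [x] outside [D1] the inner integral is 0. *)
Let int12 : (\int[m1]_x \int[m2]_y ((EFin \o F) \_ (D1 `*` D2)) (x, y))%E =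
  (Rintegral m1 D1 (fun x => Rintegral m2 D2 (fun y => F (x, y))))%:E.
Proof.
have -> : (\int[m1]_x \int[m2]_y ((EFin \o F) \_ (D1 `*` D2)) (x, y))%E =
    (\int[m1]_(x in D1) (Rintegral m2 D2 (fun y => F (x, y)))%:E)%E.
  rewrite [RHS]integral_mkcond; apply: eq_integral => x _.
  rewrite patchE; case: ifPn => xD1.
    rewrite /Rintegral fineK; last first.
      by apply: integrable_fin_num => //; apply: bmf_integrable => //; exact: bmf_pair1.
    rewrite [RHS]integral_mkcond; apply: eq_integral => y _.
    rewrite !patchE !in_setX/= xD1/=.
    by [].
  apply: integral0_eq => y _; rewrite patchE.
  by rewrite in_setX/= (negbTE xD1).
rewrite /Rintegral fineK//; apply: integrable_fin_num => //.
by apply: bmf_integrable => //; exact: bmf_Rintegral2.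
Qed.

Let int21 : (\int[m2]_y \int[m1]_x ((EFin \o F) \_ (D1 `*` D2)) (x, y))%E =
  (Rintegral m2 D2 (fun y => Rintegral m1 D1 (fun x => F (x, y))))%:E.
Proof.
have -> : (\int[m2]_y \int[m1]_x ((EFin \o F) \_ (D1 `*` D2)) (x, y))%E =
    (\int[m2]_(y in D2) (Rintegral m1 D1 (fun x => F (x, y)))%:E)%E.
  rewrite [RHS]integral_mkcond; apply: eq_integral => y _.
  rewrite patchE; case: ifPn => yD2.
    rewrite /Rintegral fineK; last first.
      by apply: integrable_fin_num => //; apply: bmf_integrable => //; exact: bmf_pair2.
    rewrite [RHS]integral_mkcond; apply: eq_integral => x _.
    by rewrite !patchE !in_setX/= yD2/= andbT.
  apply: integral0_eq => x _; rewrite patchE.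
  by rewrite in_setX/= (negbTE yD2) andbF.
rewrite /Rintegral fineK//; apply: integrable_fin_num => //.
by apply: bmf_integrable => //; exact: bmf_Rintegral1.
Qed.

Lemma bmf_swap :
  Rintegral m1 D1 (fun x => Rintegral m2 D2 (fun y => F (x, y))) =
  Rintegral m2 D2 (fun y => Rintegral m1 D1 (fun x => F (x, y))).
Proof. by apply: EFin_inj; rewrite -int12 -int21; exact: Fubini. Qed.

Lemma bmf_Rintegral_prod :
  Rintegral (sfprod m1 m2) (D1 `*` D2) F =
  Rintegral m1 D1 (fun x => Rintegral m2 D2 (fun y => F (x, y))).
Proof.
rewrite /Rintegral.
rewrite -[RHS]/(fine (Rintegral m1 D1 (fun x => Rintegral m2 D2 (fun y => F (x, y))))%:E).
by rewrite -int12 integral_mkcond; congr fine; rewrite -(integral12_prod_meas1 F1).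
Qed.

End Swap.

(** * Integration on the cube *)

Section Cube.
Variable R : realType.
Local Notation mR := (measurableTypeR R).
Local Notation X := (R * R * R)%type.
Local Notation mX := (mR * mR * mR)%type.
Local Notation leb := (@lebesgue_measure R).

Definition leb2s : {sigma_finite_measure set (mR * mR)%type -> \bar R} := sfprod leb leb.
Definition leb3s : {sigma_finite_measure set mX -> \bar R} := sfprod leb2s leb.

Lemma leb3E (D : set mX) f : Rintegral (@leb3 R) D f = Rintegral leb3s D f.
Proof. by []. Qed.

Definition side : set mR := `]-1, 1[%classic.
(** This product domain contains the ball and replaces it as domain of integration. *)
Definition cube : set mX := (side `*` side) `*` side.

Lemma measurable_side : measurable side. Proof. exact: measurable_itv. Qed.
Lemma measurable_cube : measurable cube.
Proof. by apply: measurableX; [apply: measurableX|]; exact: measurable_side. Qed.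

Lemma side_lty : (leb side < +oo)%E.
Proof. by rewrite /side lebesgue_measure_itv/= lte_fin; case: ifP => _; rewrite -?EFinB ltry. Qed.

Lemma cube_lty : (leb3s cube < +oo)%E.
Proof.
have mS := measurable_side; have fS := side_lty.
have mS2 : measurable (side `*` side) by exact: measurableX.
have fS2 := sfprodX_lty mS mS fS fS.
exact: (sfprodX_lty mS2 mS fS2 fS).
Qed.

Lemma bmf_comp d1 d2 (T1 : measurableType d1) (T2 : measurableType d2)
    (f : T2 -> R) (g : T1 -> T2) :
  bmf f -> measurable_fun setT g -> bmf (fun x => f (g x)).
Proof.
by move=> [mf [M hM]] mg; split; [exact: measurableT_comp|exists M => x].
Qed.

Lemma measurable_fst2 : measurable_fun setT (fun x : mX => x.1.1).
Proof. exact: measurableT_comp (measurable_fst) (measurable_fst). Qed.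

Lemma measurable_snd2 : measurable_fun setT (fun x : mX => x.1.2).
Proof. exact: measurableT_comp (measurable_snd) (measurable_fst). Qed.

Lemma bmf_tens (a : 'I_3 -> R -> R) : (forall i, bmf (a i : mR -> R)) ->
  bmf (tens a : mX -> R).
Proof.
move=> ba; rewrite /tens; apply: bmfM; first apply: bmfM.
- exact: (bmf_comp (ba i30) measurable_fst2).
- exact: (bmf_comp (ba i31) measurable_snd2).
- exact: (bmf_comp (ba i32) measurable_snd).
Qed.

Lemma Rintegral_tens (a : 'I_3 -> R -> R) : (forall i, bmf (a i : mR -> R)) ->
  Rintegral leb3s cube (tens a) =
  Rintegral leb side (a i30) * Rintegral leb side (a i31) * Rintegral leb side (a i32).
Proof.
move=> ba; have mS := measurable_side; have fS := side_lty.
have mS2 : measurable (side `*` side) by exact: measurableX.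
have fS2 := sfprodX_lty mS mS fS fS.
rewrite [LHS]bmf_Rintegral_prod//; last exact: bmf_tens.
have b01 : bmf (fun x : mR * mR => a i30 x.1 * a i31 x.2).
  apply: bmfM; first exact: (bmf_comp (ba i30) measurable_fst).
  exact: (bmf_comp (ba i31) measurable_snd).
rewrite [LHS](_ : _ = Rintegral leb2s (side `*` side)
    (fun x : mR * mR => Rintegral leb side (a i32) * (a i30 x.1 * a i31 x.2))).
  rewrite bmf_RintegralZ// mulrC; congr (_ * _).
  rewrite bmf_Rintegral_prod//=.
  rewrite [LHS](_ : _ = Rintegral leb side (fun x => Rintegral leb side (a i31) * a i30 x)).
    by rewrite bmf_RintegralZ// mulrC.
  by apply: eq_Rintegral => x _; rewrite bmf_RintegralZ// mulrC.
apply: eq_Rintegral => x _; rewrite /tens/= [RHS]mulrC.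
by rewrite bmf_RintegralZ.
Qed.

(* [None] stands for the endpoint +oo. *)
Definition oray_end (o : option R) : R := if o is Some a then Num.min a 1 else 1.
Definition oray (o : option R) : set mR :=
  if o is Some a then `]-oo, a[%classic else setT.

Lemma measurable_oray o : measurable (oray o).
Proof. by case: o => [a|]; [exact: measurable_itv|exact: measurableT]. Qed.

Lemma side_oray o : side `&` oray o = `]-1, oray_end o[%classic.
Proof.
case: o => [a|]; last by rewrite setIT.
apply/seteqP; split => x; rewrite /side /oray /oray_end /= !in_itv/= lt_min.
  by move=> [/andP[-> ->] ->].
by move=> /andP[-> /andP[-> ->]].
Qed.

Lemma continuous_bmf_itv (f : R -> R) (a b : R) : continuous f ->
  (forall t, ~~ (a <= t <= b) -> f t = 0) -> bmf (f : mR -> R).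
Proof.
move=> cf f0; split; first exact: continuous_measurable_fun.
have [ab|ba] := leP a b; last first.
  exists 0 => t; rewrite f0 ?normr0//; apply/negP => /andP[h1 h2].
  by have := le_lt_trans (le_trans h1 h2) ba; rewrite ltxx.
have cs : {within `[a, b], continuous (fun t => `|f t|)}.
  apply: continuous_subspaceT => t; apply: continuous_comp; first exact: cf.
  exact: norm_continuous.
have [c _ cmax] := EVT_max ab cs.
exists `|f c| => t; have [tab|tab] := boolP (a <= t <= b); first exact: cmax.
by rewrite f0// normr0.
Qed.

Lemma bmf_mollif d : 0 < d -> bmf (mollif d : mR -> R).
Proof.
move=> d0; apply: (@continuous_bmf_itv _ 0 d).
  by apply: smooth1_continuous; exact: smooth1_mollif.
move=> t; rewrite negb_and -!ltNge => /orP[t0|t0].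
  by rewrite mollif_le0// ltW.
by rewrite mollif_ge// ltW.
Qed.

Lemma bmf_dilstep d : bmf (dilstep d : mR -> R).
Proof.
split; first by apply: continuous_measurable_fun; exact/smooth1_continuous/smooth1_dilstep.
by exists 1 => t; rewrite ger0_norm ?dilstep_ge0 ?dilstep_le1.
Qed.

Lemma measurable_subl (x : R) : measurable_fun setT (fun z : mR => x - z : mR).
Proof.
apply: continuous_measurable_fun => z; apply: cvgB; first exact: cvg_cst.
exact: cvg_id.
Qed.

Lemma measurable_subr (z : R) : measurable_fun setT (fun x : mR => x - z : mR).
Proof.
apply: continuous_measurable_fun => x; apply: cvgB; last exact: cvg_cst.
exact: cvg_id.
Qed.

(** The fundamental theorem of calculus with primitive [dilstep d (x - z)]. The lower limit
    contributes nothing, because [-1 <= z] puts it where the step is still 0. *)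
Lemma Rintegral_mollif_oray d o (z : R) : 0 < d -> -1 <= z ->
  Rintegral leb side (fun x => \1_(oray o) x * mollif d (x - z)) =
  dilstep d (oray_end o - z).
Proof.
move=> d0 z1.
have -> : Rintegral leb side (fun x => \1_(oray o) x * mollif d (x - z)) =
    Rintegral leb `]-1, oray_end o[ (fun x => mollif d (x - z)).
  rewrite -side_oray Rintegral_mkcondr; apply: eq_Rintegral => x _.
  by rewrite patchE indicE; case: ifPn; rewrite ?mul1r ?mul0r.
have [c1|c1] := leP (oray_end o) (-1).
  rewrite set_itv_ge ?Rintegral_set0; last by rewrite -leNgt bnd_simp.
  by rewrite dilstep_le0//; lra.
have sh (x : R) : is_derive x (1 : R) (fun x => dilstep d (x - z)) (mollif d (x - z)).
  rewrite -[X in is_derive _ _ _ X]mulr1.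
  apply: (@is_derive1_comp _ (dilstep d) (fun x => x - z)).
    exact: smooth1_is_derive (smooth1_dilstep d).
  have := is_derive_affine 1 (- z) x.
  by congr is_derive; apply/funext => t; rewrite mul1r.
have cm : continuous (fun x : R => mollif d (x - z)).
  move=> x; apply: (@continuous_comp _ _ _ (fun x => x - z) (mollif d)).
    by apply: cvgB; [exact: cvg_id|exact: cvg_cst].
  exact/smooth1_continuous/smooth1_mollif.
have cs : continuous (fun x : R => dilstep d (x - z)).
  move=> x; apply: differentiable_continuous; apply/derivable1_diffP.
  by have [] := sh x.
rewrite /Rintegral -(integral_itv_bndoo true false); last first.
  by apply/measurable_EFinP; apply: measurable_funTS; exact: continuous_measurable_fun.
rewrite (@continuous_FTC2 _ _ (fun x => dilstep d (x - z)) _ _ c1).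
- by rewrite /= (@dilstep_le0 _ d (-1 - z))// ?subr0//; lra.
- exact: continuous_subspaceT.
- split.
  + by move=> x _; have [] := sh x.
  + apply: cvg_at_right_filter; exact: cs.
  + apply: cvg_at_left_filter; exact: cs.
- by move=> x _; rewrite derive1E; have [_ ->] := sh x.
Qed.

(** The function [z |-> h (x - z)] lives on [x - d, x], an interval of length [d]. *)
Lemma Rintegral_side_bound (h : R -> R) (x c d : R) : bmf (h : mR -> R) -> 0 <= c -> 0 < d ->
  (forall t, `|h t| <= c) -> (forall t, ~~ (0 <= t <= d) -> h t = 0) ->
  Rintegral leb side (fun z => `|h (x - z)|) <= c * d.
Proof.
move=> bh c0 d0 hc h0.
pose I : set mR := `[x - d, x]%classic.
have mI : measurable I by exact: measurable_itv.
apply: (@le_trans _ _ (Rintegral leb side (fun z => c * \1_I z))).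
  apply: bmf_le_Rintegral.
  - exact: measurable_side.
  - exact: side_lty.
  - apply: bmf_norm; exact: (bmf_comp bh (measurable_subl x)).
  - by apply: bmfZ; exact: bmf_indic.
  move=> z _; rewrite indicE /I mem_setE in_itv/=.
  have [zI|zI] := boolP (x - d <= z <= x); first by rewrite mulr1.
  rewrite h0 ?normr0 ?mulr0//; apply: contra zI => /andP[h1 h2].
  by apply/andP; split; lra.
rewrite bmf_RintegralZ//; last 3 first.
- exact: measurable_side.
- exact: side_lty.
- exact: bmf_indic.
apply: ler_wpM2l => //; rewrite /Rintegral integral_indic//; last exact: measurable_side.
have le1 : (leb (I `&` side) <= d%:E)%E.
  apply: (@le_trans _ _ (leb I)).
    by apply: le_measure; rewrite ?inE//; apply: measurableI => //; exact: measurable_side.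
  rewrite /I lebesgue_measure_itv/= lte_fin ltrBlDr ltrDl d0 -EFinB.
  by rewrite lee_fin; lra.
have := fine_le _ _ le1; apply => //.
by rewrite ge0_fin_numE// (le_lt_trans le1)// ltry.
Qed.

End Cube.

(** * Mollification on the cube *)

Section Kernel.
Variable R : realType.
Local Notation mR := (measurableTypeR R).
Local Notation X := (R * R * R)%type.
Local Notation mX := (mR * mR * mR)%type.
Local Notation leb := (@lebesgue_measure R).
Local Notation J := (Rintegral (@leb3s R) (@cube R)).
Implicit Types r : 'I_3 -> R -> R.

Definition crd (i : 'I_3) (x : X) : R :=
  if i == i30 then x.1.1 else if i == i31 then x.1.2 else x.2.

Lemma measurable_crd i : measurable_fun setT (crd i : mX -> mR).
Proof.
have [->|->|->] := ord3P i; [exact: measurable_fst2|exact: measurable_snd2|].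
exact: measurable_snd.
Qed.

(** A convolution kernel, written as a tensor product in [z] so that it can serve as a test
    function; [ker_sym] reads it as one in [x] by conversion. *)
Definition ker r (x z : X) : R := tens (fun i t => r i (crd i x - t)) z.

Lemma ker_sym r x z : ker r x z = tens (fun i t => r i (t - crd i z)) x.
Proof. by []. Qed.

Lemma crd_cube i (x : mX) : cube x -> -1 < crd i x < 1.
Proof.
move=> [[h1 h2] h3]; rewrite /side/= !in_itv/= in h1 h2 h3.
by have [->|->|->] := ord3P i.
Qed.

Lemma bmf_ker r : (forall i, bmf (r i : mR -> R)) ->
  bmf (fun p : mX * mX => ker r p.1 p.2).
Proof.
move=> br.
have h i : bmf (fun p : mX * mX => r i (crd i p.1 - crd i p.2)).
  apply: (bmf_comp (br i)); apply: measurable_funB.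
    exact: measurableT_comp (measurable_crd i) measurable_fst.
  exact: measurableT_comp (measurable_crd i) measurable_snd.
by apply: (bmfM (bmfM (h i30) (h i31)) (h i32)).
Qed.

Lemma bmf_kerl r z : (forall i, bmf (r i : mR -> R)) ->
  bmf (fun x : mX => ker r x z).
Proof. by move=> /bmf_ker/(bmf_pair2)/(_ z). Qed.

Lemma bmf_kerr r x : (forall i, bmf (r i : mR -> R)) ->
  bmf (fun z : mX => ker r x z).
Proof. by move=> /bmf_ker/(bmf_pair1)/(_ x). Qed.

(** The mass factors over the coordinates. Heights and widths may differ between coordinates,
    because the telescoped kernels mix factors of different scales. *)
Lemma Rintegral_norm_ker r x (c d : 'I_3 -> R) : (forall i, 0 < d i) ->
  (forall i, bmf (r i : mR -> R)) -> (forall i, 0 <= c i) ->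
  (forall i t, `|r i t| <= c i) ->
  (forall i t, ~~ (0 <= t <= d i) -> r i t = 0) ->
  J (fun z => `|ker r x z|) <= (c i30 * d i30) * (c i31 * d i31) * (c i32 * d i32).
Proof.
move=> d0 br c0 rc r0.
have -> : (fun z => `|ker r x z|) = tens (fun i t => `|r i (crd i x - t)|).
  by apply/funext => z; rewrite /ker /tens !normrM.
have b i : bmf ((fun t => `|r i (crd i x - t)|) : mR -> R).
  by apply: bmf_norm; exact: (bmf_comp (br i) (measurable_subl _)).
rewrite Rintegral_tens//.
have h i : 0 <= Rintegral leb (@side R) (fun t => `|r i (crd i x - t)|) <= c i * d i.
  apply/andP; split; last by apply: Rintegral_side_bound => //; exact: (r0 i).
  by apply: Rintegral_ge0 => t _; exact: normr_ge0.
have /andP[? ?] := h i30; have /andP[? ?] := h i31; have /andP[? ?] := h i32.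
by apply: ler_pM => //; [exact: mulr_ge0|exact: ler_pM].
Qed.

Lemma bmf_conv r (G : mX -> R) : (forall i, bmf (r i : mR -> R)) -> bmf G ->
  bmf (fun x : mX => J (fun z => ker r x z * G z)).
Proof.
move=> br bG.
apply: (@bmf_Rintegral2 _ _ mX mX R (@leb3s R) (@cube R) (@measurable_cube R) (@cube_lty R)
  (fun p => ker r p.1 p.2 * G p.2)).
by apply: bmfM; [exact: bmf_ker|exact: (bmf_comp bG measurable_snd)].
Qed.

Lemma norm_conv_le r (G : mX -> R) M C x : (forall i, bmf (r i : mR -> R)) -> bmf G ->
  (forall z, `|G z| <= M) -> J (fun z => `|ker r x z|) <= C ->
  `|J (fun z => ker r x z * G z)| <= C * M.
Proof.
move=> br bG GM kC; have mC := @measurable_cube R; have fC := @cube_lty R.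
apply: (@le_trans _ _ (J (fun z => M * `|ker r x z|))).
  apply: bmf_le_normr_Rintegral => //.
  - by apply: bmfM => //; exact: bmf_kerr.
  - by apply: bmfZ; apply: bmf_norm; exact: bmf_kerr.
  - by move=> z _; rewrite normrM mulrC ler_wpM2r.
rewrite bmf_RintegralZ//; last by apply: bmf_norm; exact: bmf_kerr.
by rewrite mulrC ler_wpM2r// (le_trans _ (GM (0, 0, 0))).
Qed.

End Kernel.

Import HBSimple.

(** * Mollifications converge when tested against bounded functions *)

Section ApproxIdentity.
Variable R : realType.
Local Notation mR := (measurableTypeR R).
Local Notation mX := (mR * mR * mR)%type.
Local Notation leb := (@lebesgue_measure R).
Local Notation J := (Rintegral (@leb3s R) (@cube R)).

(** Since each generating family contains [setT], the strips over generators are generating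
    rectangles. The sets whose strip is in the generated sigma-algebra form a sigma-algebra, and a
    rectangle is the intersection of two strips. *)
Lemma measurable_gen_prod d1 d2 (T1 : measurableType d1) (T2 : measurableType d2)
    (C1 : set (set T1)) (C2 : set (set T2)) :
  @measurable _ T1 = <<s C1 >> -> @measurable _ T2 = <<s C2 >> -> C1 setT -> C2 setT ->
  @measurable _ (T1 * T2)%type = <<s [set A `*` B | A in C1 & B in C2] >>.
Proof.
move=> E1 E2 C1T C2T; set CC := [set A `*` B | A in C1 & B in C2].
have sCC : sigma_algebra setT <<s CC >> by exact: smallest_sigma_algebra.
rewrite measurable_prod_measurableType; apply/seteqP; split.
  apply: smallest_sub => // _ [A mA [B mB <-]].
  have hA : <<s CC >> (A `*` setT).
    rewrite setXT.
    have : image_set_system setT fst <<s CC >> A; last by rewrite /image_set_system/= setTI.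
    move: mA; rewrite E1; apply: smallest_sub; first exact: sigma_algebra_image.
    move=> {}A CA; rewrite /image_set_system/= setTI -setXT; apply: sub_sigma_algebra.
    by exists A => //; exists setT.
  have hB : <<s CC >> (setT `*` B).
    rewrite setTX.
    have : image_set_system setT snd <<s CC >> B; last by rewrite /image_set_system/= setTI.
    move: mB; rewrite E2; apply: smallest_sub; first exact: sigma_algebra_image.
    move=> {}B CB; rewrite /image_set_system/= setTI -setTX; apply: sub_sigma_algebra.
    by exists setT => //; exists B.
  rewrite (_ : A `*` B = (A `*` setT) `&` (setT `*` B)).
    exact: (@measurableI _ (g_sigma_algebraType CC) _ _ hA hB).
  by rewrite -setXI setIT setTI.
apply: smallest_sub; first exact: smallest_sigma_algebra.
move=> _ [A CA [B CB <-]]; apply: sub_sigma_algebra; exists A.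
  by rewrite E1; exact: sub_sigma_algebra.
by exists B => //; rewrite E2; exact: sub_sigma_algebra.
Qed.

Lemma measurable_gen_oray : @measurable _ mR = <<s range (@oray R) >>.
Proof.
apply/seteqP; split; last first.
  apply: smallest_sub; first exact: sigma_algebra_measurable.
  by move=> _ [ o _ <-]; exact: measurable_oray.
rewrite [X in X `<=` _](RGenInftyO.measurableE R).
apply: smallest_sub; first exact: smallest_sigma_algebra.
by move=> _ [x ->]; apply: sub_sigma_algebra; exists (Some x).
Qed.

Lemma norm_tens_le1 (a : 'I_3 -> R -> R) x :
  (forall i t, 0 <= a i t <= 1) -> `|tens a x| <= 1.
Proof.
move=> a01.
have a0 i t : 0 <= a i t by have /andP[] := a01 i t.
have a1 i t : a i t <= 1 by have /andP[] := a01 i t.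
rewrite /tens ger0_norm; last by rewrite !mulr_ge0.
by rewrite mulr_ile1 ?mulr_ge0// mulr_ile1.
Qed.

(** Exchange of limits: the error [c N] is uniform in [n], so fixing one good [N] leaves three terms
    below e/3. *)
Lemma cvg_uniform_approx (a : nat -> nat -> R) (b c : nat -> R) (a' : nat -> R) (b' : R) :
  (forall N, a N @ \oo --> b N) -> c @ \oo --> 0 ->
  (forall N n, `|a N n - a' n| <= c N) -> (forall N, `|b N - b'| <= c N) ->
  a' @ \oo --> b'.
Proof.
move=> ab c0 aa bb; apply/cvgrPdist_lt => e e0.
have e3 : 0 < e / 3 by rewrite divr_gt0.
have [N cN] : exists N, c N < e / 3.
  have : \forall n \near \oo, c n < e / 3 by exact: (cvgr_lt 0 c0).
  by move=> [N _ /(_ N (leqnn N))]; exists N.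
near=> n.
have h1 : `|b N - a N n| < e / 3 by near: n; move/cvgrPdist_lt: (ab N); exact.
have h2 := le_lt_trans (aa N n) cN; have h3 := le_lt_trans (bb N) cN.
have -> : b' - a' n = - (b N - b') + (b N - a N n) + (a N n - a' n) by ring.
apply: le_lt_trans (ler_normD _ _) _; apply: le_lt_trans (lerD (ler_normD _ _) (lexx _)) _.
rewrite normrN; lra.
Unshelve. all: by end_near. Qed.

Lemma mul3_rearrange (a b c p q r g : R) :
  (a * b * c) * (p * q * r * g) = g * ((a * p) * (b * q) * (c * r)).
Proof. by ring. Qed.

Variables (d_ : nat -> R) (G : mX -> R).
Hypotheses (d_gt0 : forall n, 0 < d_ n) (d_cvg0 : d_ @ \oo --> 0) (bG : bmf G).

Let eta n : 'I_3 -> R -> R := fun=> mollif (d_ n).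
Let K n (x : mX) := J (fun z => ker (eta n) x z * G z).

Let mC := @measurable_cube R.
Let fC := @cube_lty R.

Let beta n i : bmf (eta n i : mR -> R). Proof. exact: bmf_mollif. Qed.

Let bK n : bmf (K n). Proof. exact: bmf_conv. Qed.

Let Kbound : exists2 C, 0 <= C & (forall n x, `|K n x| <= C) /\ (forall x, `|G x| <= C).
Proof.
have [S [S0 hS]] := @mollif_bounded R; case: bG => mG [M hM].
have M0 : 0 <= M by exact: le_trans (hM (0, 0, 0)).
exists (S * S * S * M + M); first by rewrite addr_ge0 ?mulr_ge0// ltW.
split=> [n x|x]; last first.
  by apply: le_trans (hM x) _; rewrite lerDr !mulr_ge0// ltW.
apply: (@le_trans _ _ (S * S * S * M)); last by rewrite lerDl.
apply: norm_conv_le => //.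
have Sd : S / d_ n * d_ n = S by rewrite divfK// gt_eqF.
rewrite -Sd; apply: (@Rintegral_norm_ker _ _ _ (fun=> S / d_ n) (fun=> d_ n)) => //.
- by move=> _; rewrite divr_ge0// ltW.
- by move=> i t; exact: hS.
- move=> i t; rewrite /eta negb_and -!ltNge => /orP[t0|t0].
    by rewrite mollif_le0// ltW.
  by rewrite mollif_ge// ltW.
Qed.

Definition box (o : option R * option R * option R) : set mX :=
  (oray o.1.1 `*` oray o.1.2) `*` oray o.2.

Let wcv (h : mX -> R) := (fun n => J (fun x => h x * K n x)) @ \oo --> J (fun x => h x * G x).

(** Fubini moves the mollifier onto the indicator of the box, where it integrates to a product of
    [dilstep]s. On the cube these converge pointwise to that indicator and are bounded by 1, so
    dominated convergence applies. *)
Let wcv_box o : wcv (\1_(box o)).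
Proof.
pose oo (i : 'I_3) : option R := if i == i30 then o.1.1 else if i == i31 then o.1.2 else o.2.
have mB : measurable (box o).
  by apply: measurableX; [apply: measurableX|]; exact: measurable_oray.
have BE (x : mX) : \1_(box o) x = tens (fun i t => \1_(oray (oo i)) t) x :> R.
  rewrite /box /tens !indicE !in_setX/=.
  by do 3 case: (_ \in _); rewrite ?mulr0 ?mulr1 ?mul0r.
have E n : J (fun x => \1_(box o) x * K n x) =
    J (fun z => G z * tens (fun i t => dilstep (d_ n) (oray_end (oo i) - t)) z).
  pose F (p : mX * mX) := \1_(box o) p.1 * (ker (eta n) p.1 p.2 * G p.2).
  have -> : (fun x => \1_(box o) x * K n x) = fun x => J (fun z => F (x, z)).
    apply/funext => x; rewrite /F/= bmf_RintegralZ//.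
    by apply: bmfM => //; exact: bmf_kerr.
  rewrite (bmf_swap mC mC fC fC); last first.
    apply: bmfM; first exact: (bmf_comp (bmf_indic _ mB) measurable_fst).
    by apply: bmfM; [exact: bmf_ker|exact: (bmf_comp bG measurable_snd)].
  apply: eq_Rintegral => z /set_mem Cz /=.
  have bt i : bmf ((fun t => \1_(oray (oo i)) t * eta n i (t - crd i z)) : mR -> R).
    apply: bmfM; first by apply: bmf_indic; exact: measurable_oray.
    exact: (bmf_comp (beta n i) (measurable_subr _)).
  transitivity (J (fun x => G z * tens (fun i t => \1_(oray (oo i)) t * eta n i (t - crd i z)) x)).
    apply: eq_Rintegral => x _; rewrite /F/= BE ker_sym; exact: mul3_rearrange.
  rewrite bmf_RintegralZ//; last exact: bmf_tens.
  congr (_ * _); rewrite Rintegral_tens//.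
  have z1 i : -1 <= crd i z by have /andP[/ltW] := crd_cube i Cz.
  by congr (_ * _ * _); exact: Rintegral_mollif_oray.
rewrite /wcv (funext E).
have [C C0 [_ GC]] := Kbound.
rewrite [X in _ --> X](_ : _ = J (fun z => G z * \1_(box o) z)); last first.
  by congr Rintegral; apply/funext => x; rewrite mulrC.
apply: (@bmf_dominated _ _ _ _ _ mC fC _ _ C).
- move=> n; apply: bmfM => //; apply: bmf_tens => i.
  exact: (bmf_comp (bmf_dilstep (d_ n)) (measurable_subl _)).
- by apply: bmfM => //; exact: bmf_indic.
- move=> n x _; rewrite normrM -[leRHS]mulr1; apply: ler_pM => //.
  by apply: norm_tens_le1 => i t; rewrite dilstep_ge0 dilstep_le1.
- move=> z Cz; apply: cvgM; first exact: cvg_cst.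
  have h i : (fun n => dilstep (d_ n) (oray_end (oo i) - crd i z)) @ \oo -->
      (\1_(oray (oo i)) (crd i z) : R).
    have -> : \1_(oray (oo i)) (crd i z) = (0 < oray_end (oo i) - crd i z)%R%:R :> R.
      rewrite subr_gt0 indicE; congr (_%:R); congr nat_of_bool.
      have /andP[_ z1] := crd_cube i Cz.
      rewrite /oray /oray_end; case: (oo i) => [a|]; last by rewrite z1 in_setT.
      by rewrite mem_setE in_itv/= lt_min z1 andbT.
    exact: dilstep_cvg.
  by rewrite BE /tens; apply: cvgM; [apply: cvgM|]; exact: h.
Qed.

Let wc (h : mX -> R) := bmf h /\ wcv h.

Let wc_ext h h' : h =1 h' -> wc h -> wc h'.
Proof. by move=> /funext ->. Qed.

Let wcD h1 h2 : wc h1 -> wc h2 -> wc (fun x => h1 x + h2 x).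
Proof.
move=> [b1 w1] [b2 w2]; split; first exact: bmfD.
rewrite /wcv; have E (f : mX -> R) : bmf f ->
    J (fun x => (h1 x + h2 x) * f x) = J (fun x => h1 x * f x) + J (fun x => h2 x * f x).
  move=> bf; rewrite -bmf_RintegralD//; try exact: bmfM.
  by congr Rintegral; apply/funext => x; rewrite mulrDl.
rewrite E//; under eq_fun do rewrite E//.
exact: cvgD.
Qed.

Let wcZ c h : wc h -> wc (fun x => c * h x).
Proof.
move=> [b w]; split; first exact: bmfZ.
rewrite /wcv; have E (f : mX -> R) : bmf f ->
    J (fun x => (c * h x) * f x) = c * J (fun x => h x * f x).
  move=> bf; rewrite -bmf_RintegralZ//; last exact: bmfM.
  by congr Rintegral; apply/funext => x; rewrite mulrA.
rewrite E//; under eq_fun do rewrite E//.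
by apply: cvgM => //; exact: cvg_cst.
Qed.

Let wc0 : wc (fun=> 0).
Proof.
split; first exact: bmf_cst.
rewrite /wcv; have E (f : mX -> R) : J (fun x => 0 * f x) = 0.
  rewrite [LHS](_ : _ = J (fun=> 0)).
    by rewrite Rintegral_cst// mul0r.
  by congr Rintegral; apply/funext => x; rewrite mul0r.
by rewrite E; under eq_fun do rewrite E; exact: cvg_cst.
Qed.

(** The common bound [C] on all [K n] and on [G] turns L^1 approximation of the test function into
    an error uniform in [n]. *)
Let wc_lim (h_ : nat -> mX -> R) h : (forall N, wc (h_ N)) -> bmf h ->
  (fun N => J (fun x => `|h_ N x - h x|)) @ \oo --> 0 -> wc h.
Proof.
move=> wh bh h0; split => //; have [C C0 [KC GC]] := Kbound.
apply: (@cvg_uniform_approx (fun N n => J (fun x => h_ N x * K n x))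
  (fun N => J (fun x => h_ N x * G x))
  (fun N => C * J (fun x => `|h_ N x - h x|))).
- by move=> N; have [] := wh N.
- by rewrite -(mulr0 C); apply: cvgM => //; exact: cvg_cst.
- move=> N n; have [bN _] := wh N.
  rewrite -bmf_RintegralB//; try exact: bmfM.
  rewrite -bmf_RintegralZ//; last by apply: bmf_norm; exact: bmfB.
  apply: bmf_le_normr_Rintegral => //.
  + by apply: bmfB; exact: bmfM.
  + by apply: bmfZ; apply: bmf_norm; exact: bmfB.
  + by move=> x _; rewrite -mulrBl normrM mulrC ler_wpM2r.
- move=> N; have [bN _] := wh N.
  rewrite -bmf_RintegralB//; try exact: bmfM.
  rewrite -bmf_RintegralZ//; last by apply: bmf_norm; exact: bmfB.
  apply: bmf_le_normr_Rintegral => //.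
  + by apply: bmfB; exact: bmfM.
  + by apply: bmfZ; apply: bmf_norm; exact: bmfB.
  + by move=> x _; rewrite -mulrBl normrM mulrC ler_wpM2r.
Qed.

Let measurable_gen_box : @measurable _ mX = <<s range box >>.
Proof.
have rT : range (@oray R) setT by exists None.
rewrite (measurable_gen_prod (measurable_gen_prod measurable_gen_oray
  measurable_gen_oray rT rT) measurable_gen_oray _ rT); last first.
  by exists setT => //; exists setT => //; rewrite setXTT.
congr (<<s _ >>); apply/seteqP; split.
  by move=> _ [_ [_ [ o1 _ <-] [_ [ o2 _ <-] <-]] [_ [ o3 _ <-] <-]]; exists (o1, o2, o3).
move=> _ [[[ o1 o2] o3] _ <-]; exists (oray o1 `*` oray o2).
  by exists (oray o1); [exists o1|exists (oray o2) => //; exists o2].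
by exists (oray o3) => //; exists o3.
Qed.

Let box_setI : setI_closed (range box).
Proof.
have tI (o o' : option R) : exists o'', oray o `&` oray o' = oray o''.
  case: o o' => [a|] [b|].
  - exists (Some (Num.min a b)); apply/seteqP; split => x; rewrite /oray/= !in_itv/= lt_min.
      by move=> [-> ->].
    by move=> /andP[-> ->].
  - by exists (Some a); rewrite setIT.
  - by exists (Some b); rewrite setTI.
  - by exists None; rewrite setTI.
move=> _ _ [ o _ <-] [ o' _ <-].
have [ o1 e1] := tI o.1.1 o'.1.1; have [ o2 e2] := tI o.1.2 o'.1.2.
have [ o3 e3] := tI o.2 o'.2.
by exists (o1, o2, o3) => //; rewrite /box/= -e1 -e2 -e3 !setXI.
Qed.

(** Dynkin's theorem: boxes are a generating pi-system. Complements and finite disjoint unions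
    follow by linearity, countable disjoint unions by [wc_lim]. *)
Let wc_indic (A : set mX) : measurable A -> wc (\1_A).
Proof.
move=> mA; move: (mA); rewrite {1}measurable_gen_box; move: A {mA}.
have wT : wc (\1_[set: mX]).
  have mT : measurable [set: mX] by exact: measurableT.
  split; first exact: bmf_indic.
  by have := @wcv_box (None, None, None); rewrite /box/= !setXTT.
apply: (dynkin_induction measurable_gen_box box_setI wT).
- move=> _ [ o _ <-]; split; last exact: wcv_box.
  by apply: bmf_indic; apply: measurableX; [apply: measurableX|]; exact: measurable_oray.
- move=> S mS wS; apply: wc_ext (wcD wT (wcZ (-1) wS)) => x /=.
  by rewrite !indicE in_setT in_setC; case: (x \in S) => /=; rewrite ?mulr1 ?mulr0 ?subrr ?addr0.
- move=> F mF tF wF.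
  (* The finite unions increase to the whole union, so at each point the indicators are eventually
     equal to the limit; L^1 convergence follows by domination. *)
  pose A N := \big[setU/set0]_(k < N) F k.
  have mA N : measurable (A N) by exact: bigsetU_measurable.
  have mU : measurable (\bigcup_k F k) by exact: bigcupT_measurable.
  have AE N x : A N x <-> exists2 k, (k < N)%N & F k x.
    by rewrite /A -bigcup_mkord; split=> [[k /= kN Fx]|[k kN Fx]]; exists k.
  apply: (@wc_lim (fun N => \1_(A N))); last 2 first.
  + exact: bmf_indic.
  + rewrite (_ : 0 = J (fun=> 0)); last by rewrite Rintegral_cst// mul0r.
    apply: (@bmf_dominated _ _ _ _ _ mC fC _ _ 1).
    * by move=> n; apply: bmf_norm; apply: bmfB; exact: bmf_indic.
    * exact: bmf_cst.
    * move=> n x _; rewrite normr_id !indicE.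
      by case: (_ \in _); case: (_ \in _); rewrite ?subrr ?subr0 ?sub0r ?normrN ?normr0 ?normr1.
    * move=> x _; apply: cvg_near_cst.
      have [[k _ Fk]|nF] := pselect ((\bigcup_k F k) x).
        exists k.+1 => // N /= kN; rewrite !indicE !mem_set ?subrr ?normr0//.
          by exists k.
        by apply/AE; exists k.
      apply: nearW => N; rewrite !indicE !memNset ?subrr ?normr0//.
      by move=> /AE[k _ Fk]; apply: nF; exists k.
  + elim=> [|N IH].
      by apply: wc_ext wc0 => x; rewrite /A big_ord0 indicE in_set0.
    apply: wc_ext (wcD IH (wF N)) => x; rewrite /A big_ord_recr/= -/(A N) !indicE in_setU.
    have [xA|xA] := boolP (x \in A N); last by rewrite add0r.
    have [xF|xF] := boolP (x \in F N); last by rewrite addr0.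
    move/set_mem: xA => /AE[k kN Fk]; move/set_mem: xF => FN.
    have := tF k N I I (ex_intro _ x (conj Fk FN)) => kNe.
    by rewrite kNe ltnn in kN.
Qed.

Let wc_sfun (g : {sfun mX >-> R}) : wc (fun x => g x).
Proof.
apply: (wc_ext (fun x => esym (fimfunEord g x))).
set s := finmap.enum_fset _; set n := size s.
have H (m : nat) (y : nat -> R) (A : nat -> set mX) : (forall i, measurable (A i)) ->
    wc (fun x => \sum_(i < m) y i * \1_(A i) x).
  move=> mA; elim: m => [|m IH].
    by apply: wc_ext wc0 => x; rewrite big_ord0.
  apply: wc_ext (wcD IH (wcZ (y m) (wc_indic (mA m)))) => x.
  by rewrite big_ord_recr.
by apply: (H n (fun i => s`_i) (fun i => g @^-1` [set s`_i])).
Qed.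

(** Simple functions are dense in L^1 of the cube, so the case of indicators extends to all bounded
    [h] through [wc_lim]. *)
Lemma approx_identity h : bmf h ->
  (fun n => J (fun x => h x * J (fun z => ker (fun=> mollif (d_ n)) x z * G z))) @ \oo
  --> J (fun x => h x * G x).
Proof.
move=> bh.
have [g [ig gh gh1]] := approximation_sfun_integrable mC (bmf_integrable mC fC bh).
suff [] : wc h by [].
apply: (@wc_lim (fun n => g n)) => //.
have bg n : bmf (g n) by have [] := wc_sfun (g n).
have : (fun n => fine (\int[leb3s R]_(z in cube (R:=R))
    `|(EFin \o h) z - (g n z)%:E|)%E) @ \oo --> fine 0%:E.
  by apply: fine_cvg.
apply: cvg_trans; apply: near_eq_cvg; apply: nearW => n.
rewrite /Rintegral; congr fine; apply: eq_integral => x _.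
by rewrite /= distrC.
Qed.

End ApproxIdentity.

(** * Weak gradients and compensated compactness *)

Section WeakGradient.
Variable R : realType.
Local Notation mR := (measurableTypeR R).
Local Notation X := (R * R * R)%type.
Local Notation mX := (mR * mR * mR)%type.
Local Notation J := (Rintegral (@leb3s R) (@cube R)).
Implicit Types (a r s : 'I_3 -> R -> R).

Let mC := @measurable_cube R.
Let fC := @cube_lty R.

(** The weak gradient of one component, tested only against tensor products supported in
    [-1/2, 1/2]^3 and integrated over the cube. *)
Definition wgrad (u : mX -> R) (g : 'I_3 -> mX -> R) :=
  forall a, (forall i, smooth1 (a i)) -> (forall i t, 2^-1 <= `|t| -> a i t = 0) ->
  forall j, J (fun x => u x * tens (dtens j a) x) = - J (fun x => g j x * tens a x).

Definition smooth_supp (d : R) r := (forall i, smooth1 (r i)) /\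
  forall i t, ~~ (0 <= t <= d) -> r i t = 0.

Lemma derive1_near0 (f : R -> R) (t : R) : (\near t, f t = 0) -> derive1 f t = 0.
Proof.
move=> f0; have H : is_derive t (1 : R) f 0.
  by apply: (@near_eq_is_derive R R R (fun=> 0)); apply: filterS f0.
by rewrite derive1E; apply: derive_val.
Qed.

Lemma derive1_out (f : R -> R) (d t : R) : (forall t, ~~ (0 <= t <= d) -> f t = 0) ->
  ~~ (0 <= t <= d) -> derive1 f t = 0.
Proof.
move=> f0; rewrite negb_and -!ltNge => /orP[t0|t0]; apply: derive1_near0; near=> x;
  apply: f0; rewrite negb_and -!ltNge; apply/orP; [left|right]; near: x.
- exact: lt_nbhsl.
- exact: lt_nbhsr.
Unshelve. all: by end_near. Qed.

Lemma derive1_outnorm (f : R -> R) (c t : R) : (forall t, c <= `|t| -> f t = 0) ->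
  c < `|t| -> derive1 f t = 0.
Proof.
move=> f0 ct; apply: derive1_near0; near=> x; apply: f0; apply/ltW; near: x.
have : (fun x : R => `|x|) x @[x --> t] --> `|t| by exact: norm_continuous.
by move=> /cvgr_gt; exact.
Unshelve. all: by end_near. Qed.

Lemma smooth_supp_dtens d r i : smooth_supp d r -> smooth_supp d (dtens i r).
Proof.
move=> [sr r0]; split; first exact: smooth1_dtens.
move=> k t td; rewrite /dtens; case: ifP => _; last exact: r0.
by apply: derive1_out td; exact: r0.
Qed.

Lemma smooth_supp_bmf d r : smooth_supp d r -> forall i, bmf (r i : mR -> R).
Proof.
move=> [sr r0] i; apply: (@continuous_bmf_itv _ _ 0 d); last exact: r0.
exact: smooth1_continuous.
Qed.

Lemma derive1_refl (f : R -> R) (c : R) : smooth1 f ->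
  derive1 (fun t : R => f (c - t)) = fun t => - derive1 f (c - t).
Proof.
move=> sf; apply: derive1_eq => x.
rewrite -mulrN1; apply: (@is_derive1_comp _ f (fun x => c - x)).
  exact: smooth1_is_derive.
have := is_derive_affine (-1) c x.
by congr is_derive; apply/funext => t; rewrite mulN1r addrC.
Qed.

Lemma smooth1_refl (f : R -> R) (c : R) : smooth1 f -> smooth1 (fun t : R => f (c - t)).
Proof.
move=> /(@smooth1_affine _ f (-1) c); congr smooth1; apply/funext => t.
by rewrite mulN1r addrC.
Qed.

Lemma derive1_shift (f : R -> R) (c : R) : smooth1 f ->
  derive1 (fun t : R => f (t - c)) = fun t => derive1 f (t - c).
Proof.
move=> sf; apply: derive1_eq => x.
rewrite -[X in is_derive _ _ _ X]mulr1; apply: (@is_derive1_comp _ f (fun x => x - c)).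
  exact: smooth1_is_derive.
have := is_derive_affine 1 (- c) x.
by congr is_derive; apply/funext => t; rewrite mul1r.
Qed.

Lemma smooth1_shift (f : R -> R) (c : R) : smooth1 f -> smooth1 (fun t : R => f (t - c)).
Proof.
move=> /(@smooth1_affine _ f 1 (- c)); congr smooth1; apply/funext => t.
by rewrite mul1r.
Qed.

(** The test function is [z |-> ker r x z]. For |x_k| <= 1/4 and [d < 4^-1] it is supported in
    [x_k - d, x_k], hence within radius 1/2. The sign from the reflection [x - z] cancels that of
    the weak derivative. *)
Lemma wgrad_ker u g d r x i : wgrad u g -> (bmf u) -> smooth_supp d r -> d < 4^-1 ->
  (forall k, `|crd k x| <= 4^-1) ->
  J (fun z => ker r x z * g i z) = J (fun z => ker (dtens i r) x z * u z).
Proof.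
move=> wu bu ar d4 x4; have [sr r0] := ar.
pose a k t := r k (crd k x - t).
have sa k : smooth1 (a k) by exact: smooth1_refl.
have a0 k t : 2^-1 <= `|t| -> a k t = 0.
  move=> t2; apply: r0; apply/negP => /andP[h1 h2].
  have := x4 k; rewrite ler_norml => /andP[h3 h4].
  by move: t2; rewrite leNgt ltr_norml => /negP; apply; apply/andP; split; lra.
have := wu a sa a0 i.
have -> : (fun x0 => u x0 * tens (dtens i a) x0) =
    (fun z => - (ker (dtens i r) x z * u z)).
  apply/funext => z; rewrite /ker /tens /dtens /a.
  by have [->|->|->] := ord3P i; rewrite /= derive1_refl//; ring.
rewrite bmf_RintegralN//; last first.
  by apply: bmfM => //; apply: bmf_kerr; apply: smooth_supp_bmf; exact: smooth_supp_dtens ar.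
move=> /oppr_inj ->; congr Rintegral; apply/funext => z; exact: mulrC.
Qed.

(** Both sides are minus the integral of [v] against the mixed second derivative. The radius 1/4 <
    1/2 makes first derivatives of [a] admissible test functions too. *)
Lemma wgrad_curl v g a i j : wgrad v g -> (forall i, smooth1 (a i)) ->
  (forall i t, 4^-1 <= `|t| -> a i t = 0) ->
  J (fun x => g j x * tens (dtens i a) x) = J (fun x => g i x * tens (dtens j a) x).
Proof.
move=> wv sa a0.
have h k : forall i t, 2^-1 <= `|t| -> dtens k a i t = 0.
  move=> l t t2; rewrite /dtens; case: ifP => _.
    by apply: derive1_outnorm (a0 l) _; apply: lt_le_trans t2; lra.
  by apply: a0; apply: le_trans t2; lra.
apply: oppr_inj; rewrite -(wv _ (smooth1_dtens i sa) (h i)).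
by rewrite -(wv _ (smooth1_dtens j sa) (h j)) tens_dtensC.
Qed.

Lemma swap_ker r (p q : mX -> R) : (forall i, bmf (r i : mR -> R)) -> bmf p -> bmf q ->
  J (fun x => p x * J (fun z => ker r x z * q z)) =
  J (fun z => q z * J (fun x => ker r x z * p x)).
Proof.
move=> br bp bq.
pose F (w : mX * mX) := p w.1 * (ker r w.1 w.2 * q w.2).
have bF : bmf F.
  apply: bmfM; first exact: (bmf_comp bp measurable_fst).
  by apply: bmfM; [exact: bmf_ker|exact: (bmf_comp bq measurable_snd)].
transitivity (J (fun x => J (fun z => F (x, z)))).
  apply: eq_Rintegral => x _; rewrite /F/= bmf_RintegralZ//.
  by apply: bmfM => //; exact: bmf_kerr.
rewrite (bmf_swap mC mC fC fC bF); apply: eq_Rintegral => z _.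
rewrite -bmf_RintegralZ//; last by apply: bmfM => //; exact: bmf_kerl.
by congr Rintegral; apply/funext => x; rewrite /F/=; ring.
Qed.

End WeakGradient.

(** * The mollified antisymmetric form and curl-freeness *)

Section Curl.
Variable R : realType.
Local Notation mR := (measurableTypeR R).
Local Notation X := (R * R * R)%type.
Local Notation mX := (mR * mR * mR)%type.
Local Notation J := (Rintegral (@leb3s R) (@cube R)).
Implicit Types (a r s : 'I_3 -> R -> R).

Let mC := @measurable_cube R.
Let fC := @cube_lty R.

Definition cut3 : 'I_3 -> R -> R := fun=> @cutoff R.
Definition phi : X -> R := tens cut3.

Lemma smooth1_cut3 i : smooth1 (cut3 i). Proof. exact: smooth1_cutoff. Qed.

Lemma bmf_cut3 i : bmf (cut3 i : mR -> R).
Proof.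
apply: (@continuous_bmf_itv _ _ (- 4^-1) 4^-1).
  exact/smooth1_continuous/smooth1_cutoff.
by move=> t; rewrite -ler_norml -ltNge => /ltW; exact: cutoff_eq0.
Qed.

Lemma bmf_dcut3 i j : bmf (dtens i cut3 j : mR -> R).
Proof.
apply: (@continuous_bmf_itv _ _ (- 4^-1) 4^-1).
  by apply: smooth1_continuous; apply: smooth1_dtens; exact: smooth1_cut3.
move=> t; rewrite -ler_norml -ltNge => /ltW t4; rewrite /dtens; case: ifP => _.
  exact: derive1_cutoff_eq0.
exact: cutoff_eq0.
Qed.

Lemma bmf_phi : bmf (phi : mX -> R). Proof. by apply: bmf_tens => i; exact: bmf_cut3. Qed.

Lemma tens_eq0 a k (x : X) : a k (crd k x) = 0 -> tens a x = 0.
Proof. by rewrite /tens; have [->|->|->] := ord3P k => /= ->; rewrite ?mul0r ?mulr0 ?mul0r. Qed.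

Lemma phi_eq0 k x : 4^-1 <= `|crd k x| -> phi x = 0.
Proof. by move=> xk; apply: (@tens_eq0 _ k); exact: cutoff_eq0. Qed.

Lemma dphi_eq0 i k x : 4^-1 <= `|crd k x| -> tens (dtens i cut3) x = 0.
Proof.
move=> xk; apply: (@tens_eq0 _ k); rewrite /dtens; case: ifP => _.
  exact: derive1_cutoff_eq0.
exact: cutoff_eq0.
Qed.

(** The dichotomy used under every integral weighted by [phi]: either [wgrad_ker] applies at [x], or
    the weight and its derivatives vanish. *)
Lemma phi_supp (x : X) : (forall k, `|crd k x| <= 4^-1) \/ exists k, 4^-1 <= `|crd k x|.
Proof.
have [h|/existsNP[k /negP]] := pselect (forall k, `|crd k x| <= 4^-1); first by left.
by rewrite -ltNge => /ltW; right; exists k.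
Qed.

(** Stands in for the integral of [phi * g * h]; only [g] is mollified. *)
Definition mollform (k : X -> X -> R) (g h : mX -> R) :=
  J (fun x => phi x * h x * J (fun z => k x z * g z)).

(* Testing curl-freeness of [gv] against [phi * r (. - z)] trades the derivatives
   of [u] for [u] itself. *)
Lemma mollform_curl u gu v gv d r i j : bmf u -> (forall i, bmf (gu i)) ->
  bmf v -> (forall i, bmf (gv i)) -> wgrad u gu -> wgrad v gv -> smooth_supp d r -> d < 4^-1 ->
  mollform (ker r) (gu i) (gv j) - mollform (ker r) (gu j) (gv i) =
  - J (fun x => (tens (dtens i cut3) x * gv j x - tens (dtens j cut3) x * gv i x) *
     J (fun z => ker r x z * u z)).
Proof.
move=> bu bgu bv bgv wu wv ar d4; have [sr r0] := ar.
have bdr k l : bmf (dtens k r l : mR -> R) by apply: smooth_supp_bmf; exact: smooth_supp_dtens ar.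
have br k : bmf (r k : mR -> R) by exact: smooth_supp_bmf ar k.
have bphi := bmf_phi.
have bdphi k : bmf (tens (dtens k cut3) : mX -> R).
  by apply: bmf_tens => l; exact: bmf_dcut3.
(* On the support of [phi] the derivative passes from [u] to the kernel; [swap_ker] then moves the
   convolution onto [phi * gv l]. *)
have A1 k l : mollform (ker r) (gu k) (gv l) =
    J (fun z => u z * J (fun x => ker (dtens k r) x z * (phi x * gv l x))).
  rewrite -(swap_ker (bdr k) (bmfM bphi (bgv l)) bu).
  apply: eq_Rintegral => x _; have [x4|[m xm]] := phi_supp x.
    by congr (_ * _); exact: (wgrad_ker _ wu bu ar d4 x4).
  by rewrite (phi_eq0 xm) !mul0r.
rewrite !A1 swap_ker//; last by apply: bmfB; exact: bmfM.
have bI k l : bmf (fun z : mX => J (fun x => ker (dtens k r) x z * (phi x * gv l x))).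
  apply: (@bmf_Rintegral1 _ _ mX mX R (@leb3s R) (@cube R) mC fC
     (fun w => ker (dtens k r) w.1 w.2 * (phi w.1 * gv l w.1))).
  apply: bmfM; first exact: bmf_ker.
  by apply: bmfM; [exact: (bmf_comp bphi measurable_fst)|exact: (bmf_comp (bgv l) measurable_fst)].
rewrite -bmf_RintegralB//; try by apply: bmfM.
pose B x := tens (dtens i cut3) x * gv j x - tens (dtens j cut3) x * gv i x.
have bB : bmf (B : mX -> R) by apply: bmfB; exact: bmfM.
have bN : bmf (fun z : mX => u z * J (fun x => ker r x z * B x)).
  apply: bmfM => //.
  apply: (@bmf_Rintegral1 _ _ mX mX R (@leb3s R) (@cube R) mC fC
     (fun w => ker r w.1 w.2 * B w.1)).
  by apply: bmfM; [exact: bmf_ker|exact: (bmf_comp bB measurable_fst)].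
rewrite -bmf_RintegralN//; apply: eq_Rintegral => z _.
rewrite -mulrBr -mulrN; congr (_ * _).
pose a k t := cutoff t * r k (t - crd k z).
have sa k : smooth1 (a k).
  by apply: smooth1M; [exact: smooth1_cutoff|exact: smooth1_shift].
have a0 k t : 4^-1 <= `|t| -> a k t = 0.
  by move=> t4; rewrite /a cutoff_eq0// mul0r.
have da k t : derive1 (a k) t =
    derive1 (cut3 k) t * r k (t - crd k z) + cut3 k t * derive1 (r k) (t - crd k z).
  have ss := smooth1_shift (crd k z) (sr k).
  have H (x : R) : is_derive x (1 : R) (a k)
      (derive1 (cut3 k) x * r k (x - crd k z) + cut3 k x * derive1 (r k) (x - crd k z)).
    have d1 := smooth1_is_derive x (smooth1_cut3 k).
    have d2 := smooth1_is_derive x ss.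
    apply: is_derive_eqr (is_deriveM d1 d2) _.
    by rewrite derive1_shift// /GRing.scale/=; ring.
  by rewrite (derive1_eq H).
have dt k x : tens (dtens k a) x =
    tens (dtens k cut3) x * ker r x z + phi x * ker (dtens k r) x z.
  rewrite /phi !ker_sym /tens /dtens.
  by have [->|->|->] := ord3P k; rewrite /= da /a/= /cut3; ring.
have E2 k l : J (fun x => gv l x * tens (dtens k a) x) =
   J (fun x => ker r x z * (tens (dtens k cut3) x * gv l x)) +
   J (fun x => ker (dtens k r) x z * (phi x * gv l x)).
  rewrite -bmf_RintegralD//.
  - by apply: eq_Rintegral => x _; rewrite dt; ring.
  - by apply: bmfM; [exact: bmf_kerl|exact: bmfM].
  - by apply: bmfM; [exact: bmf_kerl|exact: bmfM].
(* By [E2] each side is a cutoff term plus a kernel term. The kernel terms are those of [A1], so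
   their difference is minus the difference of the cutoff terms. *)
have := wgrad_curl i j wv sa a0; rewrite !E2 => E.
have -> : J (fun x => ker r x z * B x) =
   J (fun x => ker r x z * (tens (dtens i cut3) x * gv j x)) -
   J (fun x => ker r x z * (tens (dtens j cut3) x * gv i x)).
  rewrite -bmf_RintegralB//; try by apply: bmfM; [exact: bmf_kerl|exact: bmfM].
  by congr Rintegral; apply/funext => x; rewrite -mulrBr.
lra.
Qed.

Lemma dphi_bounded : exists2 C : R, 0 <= C & forall i x, `|tens (dtens i cut3) x| <= C.
Proof.
have h i : exists2 C : R, 0 <= C & forall x, `|tens (dtens i cut3) x| <= C.
  have [_ [M hM]] : bmf (tens (dtens i cut3) : mX -> R).
    by apply: bmf_tens => l; exact: bmf_dcut3.
  by exists M => //; apply: le_trans (hM (0, 0, 0)).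
have [C0 p0 h0] := h i30; have [C1 p1 h1] := h i31; have [C2 p2 h2] := h i32.
exists (C0 + C1 + C2); first by rewrite !addr_ge0.
move=> i x; have [->|->|->] := ord3P i.
- by apply: le_trans (h0 x) _; lra.
- by apply: le_trans (h1 x) _; lra.
- by apply: le_trans (h2 x) _; lra.
Qed.

(** After [mollform_curl] the differentiated kernel acts on [u], and [wgrad_ker] moves that
    derivative back to [gu k]. So only the mass [c] of [s] itself enters, and neither its derivative
    nor the size of [u]. *)
Lemma mollform_dker_le : exists2 C : R, 0 <= C &
  forall u gu v gv M c d s k i j, bmf u -> (forall i, bmf (gu i)) ->
  bmf v -> (forall i, bmf (gv i)) -> wgrad u gu -> wgrad v gv -> smooth_supp d s -> d < 4^-1 ->
  (forall i x, `|gu i x| <= M) -> (forall i x, `|gv i x| <= M) ->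
  (forall x, J (fun z => `|ker s x z|) <= c) ->
  `|mollform (ker (dtens k s)) (gu i) (gv j) - mollform (ker (dtens k s)) (gu j) (gv i)|
     <= C * (M * M * c).
Proof.
have [C C0 hC] := dphi_bounded.
exists (2 * C * fine (@leb3s R (@cube R))); first by rewrite !mulr_ge0// fine_ge0.
move=> u gu v gv M c d s k i j bu bgu bv bgv wu wv adms d4 uM vM sc.
have M0 : 0 <= M by exact: le_trans (uM i (0, 0, 0)).
have bdr l : bmf (dtens k s l : mR -> R) by apply: smooth_supp_bmf; exact: smooth_supp_dtens adms.
have bdphi l : bmf (tens (dtens l cut3) : mX -> R).
  by apply: bmf_tens => m; exact: bmf_dcut3.
rewrite (mollform_curl i j bu bgu bv bgv wu wv (smooth_supp_dtens k adms) d4) normrN.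
rewrite (_ : _ * _ * fine _ * _ =
  ((C * M + C * M) * (c * M)) * fine (@leb3s R (@cube R))); last ring.
apply: bmf_Rintegral_bound => //.
  by apply: bmfM; [by apply: bmfB; exact: bmfM|exact: bmf_conv].
move=> x _; have [x4|[m xm]] := phi_supp x.
  rewrite normrM; apply: ler_pM => //.
    apply: le_trans (ler_normB _ _) _.
    by apply: lerD; rewrite normrM; apply: ler_pM => //; exact: hC.
  rewrite -(wgrad_ker k wu bu adms d4 x4).
  by apply: norm_conv_le => //; exact: smooth_supp_bmf adms.
have c0 : 0 <= c.
  by apply: le_trans (sc (0, 0, 0)); apply: Rintegral_ge0 => z _; exact: normr_ge0.
by rewrite !(dphi_eq0 _ xm) !mul0r subrr mul0r normr0 !mulr_ge0 ?addr_ge0 ?mulr_ge0.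
Qed.

End Curl.

(** * Change of the mollification scale *)

Section Minors.
Variable R : realType.
Local Notation mR := (measurableTypeR R).
Local Notation X := (R * R * R)%type.
Local Notation mX := (mR * mR * mR)%type.
Local Notation J := (Rintegral (@leb3s R) (@cube R)).
Implicit Types (a r s : 'I_3 -> R -> R).

Let mC := @measurable_cube R.
Let fC := @cube_lty R.

Lemma mollform_sum r r' s0 s1 s2 (g h : mX -> R) :
  (forall i, bmf (r' i : mR -> R)) -> (forall i, bmf (s0 i : mR -> R)) ->
  (forall i, bmf (s1 i : mR -> R)) -> (forall i, bmf (s2 i : mR -> R)) ->
  bmf g -> bmf h ->
  (forall x z, ker r x z = ker r' x z + (ker s0 x z + (ker s1 x z + ker s2 x z))) ->
  mollform (ker r) g h = mollform (ker r') g h +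
    (mollform (ker s0) g h + (mollform (ker s1) g h + mollform (ker s2) g h)).
Proof.
move=> br b0 b1 b2 bg bh E.
have bA (q : 'I_3 -> R -> R) : (forall i, bmf (q i : mR -> R)) ->
    bmf (fun x : mX => phi x * h x * J (fun z => ker q x z * g z)).
  by move=> bq; apply: bmfM; [apply: bmfM => //; exact: bmf_phi|exact: bmf_conv].
have bk (q : 'I_3 -> R -> R) x : (forall i, bmf (q i : mR -> R)) ->
    bmf (fun z : mX => ker q x z * g z).
  by move=> bq; apply: bmfM => //; exact: bmf_kerr.
pose T q x := phi x * h x * J (fun z => ker q x z * g z).
transitivity (J (fun x => T r' x + (T s0 x + (T s1 x + T s2 x)))); last first.
  rewrite (bmf_RintegralD mC fC (bA _ br) (bmfD (bA _ b0) (bmfD (bA _ b1) (bA _ b2)))).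
  rewrite (bmf_RintegralD mC fC (bA _ b0) (bmfD (bA _ b1) (bA _ b2))).
  by rewrite (bmf_RintegralD mC fC (bA _ b1) (bA _ b2)).
apply: eq_Rintegral => x _; rewrite /T -!mulrDr; congr (_ * _).
rewrite -(bmf_RintegralD mC fC (bk _ x b1) (bk _ x b2)).
rewrite -(bmf_RintegralD mC fC (bk _ x b0) (bmfD (bk _ x b1) (bk _ x b2))).
rewrite -(bmf_RintegralD mC fC (bk _ x br) (bmfD (bk _ x b0) (bmfD (bk _ x b1) (bk _ x b2)))).
by apply: eq_Rintegral => z _; rewrite E !mulrDl.
Qed.

Lemma prod3_telescope (a0 a1 a2 b0 b1 b2 p0 p1 p2 : R) :
  p0 = a0 - b0 -> p1 = a1 - b1 -> p2 = a2 - b2 ->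
  a0 * a1 * a2 = b0 * b1 * b2 + (p0 * a1 * a2 + (b0 * p1 * a2 + b0 * b1 * p2)).
Proof. by move=> -> -> ->; ring. Qed.

(* [Psi] is meant to be [dilstep d - dilstep d']. *)
Lemma ker_telescope (Psi : R -> R) d d' x z :
  (forall t, derive1 Psi t = mollif d t - mollif d' t) ->
  ker (fun=> mollif d) x z = ker (fun=> mollif d') x z +
    (ker (dtens i30 (fun l => if l == i30 then Psi else mollif d)) x z +
    (ker (dtens i31 (fun l => if l == i30 then mollif d'
                              else if l == i31 then Psi else mollif d)) x z +
     ker (dtens i32 (fun l => if l == i32 then Psi else mollif d')) x z)).
Proof. by move=> dPsi; exact: (prod3_telescope (dPsi _) (dPsi _) (dPsi _)). Qed.

Lemma sub3_le (a a' b b' p0 p1 p2 q0 q1 q2 e : R) :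
  a = a' + (p0 + (p1 + p2)) -> b = b' + (q0 + (q1 + q2)) ->
  `|p0 - q0| <= e -> `|p1 - q1| <= e -> `|p2 - q2| <= e ->
  `|(a - b) - (a' - b')| <= e + e + e.
Proof.
move=> -> -> h0 h1 h2.
rewrite (_ : _ - _ = (p0 - q0) + (p1 - q1) + (p2 - q2)); last ring.
apply: le_trans (ler_normD _ _) _; apply: lerD => //.
by apply: le_trans (ler_normD _ _) _; apply: lerD.
Qed.

Let eta (d : R) : 'I_3 -> R -> R := fun=> mollif d.

Definition mollminor (d : R) (gu gv : 'I_3 -> mX -> R) i j :=
  mollform (ker (eta d)) (gu i) (gv j) - mollform (ker (eta d)) (gu j) (gv i).

Lemma smooth_supp_eta d' d i : 0 < d' -> d' <= d -> forall t : R, ~~ (0 <= t <= d) -> eta d' i t = 0.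
Proof.
move=> d0 dd t; rewrite /eta negb_and -!ltNge => /orP[t0|t0].
  by rewrite mollif_le0// ltW.
by rewrite mollif_ge// (le_trans dd)// ltW.
Qed.

(* [eta d - eta d'] telescopes into three derivatives of kernels of mass O(d);
   such a derivative is absorbed by [u], which leaves the factor d, uniformly in
   the sequence. *)
Lemma mollminor_le : exists2 C : R, 0 <= C &
  forall u gu v gv M d d' i j, bmf u -> (forall i, bmf (gu i)) ->
  bmf v -> (forall i, bmf (gv i)) -> wgrad u gu -> wgrad v gv ->
  0 < d' -> d' <= d -> d < 4^-1 ->
  (forall i x, `|gu i x| <= M) -> (forall i x, `|gv i x| <= M) ->
  `|mollminor d gu gv i j - mollminor d' gu gv i j| <= C * (M * M * d).
Proof.
have [C C0 hC] := @mollform_dker_le R; have [S [S0 hS]] := @mollif_bounded R.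
exists (3 * (C * (S * S))); first by rewrite !mulr_ge0// ltW.
move=> u gu v gv M d d' i j bu bgu bv bgv wu wv d'0 dd' d4 uM vM.
have d0 : 0 < d by exact: lt_le_trans d'0 dd'.
pose Psi (t : R) := dilstep d t + -1 * dilstep d' t.
have sPsi : smooth1 Psi.
  apply: smooth1D; first exact: smooth1_dilstep.
  by apply: smooth1M; [exact: smooth1_cst|exact: smooth1_dilstep].
have dPsi (t : R) : derive1 Psi t = mollif d t - mollif d' t.
  have H (x : R) : is_derive x (1 : R) Psi (mollif d x - mollif d' x).
    have d1 := smooth1_is_derive x (smooth1_dilstep d).
    have d2 := smooth1_is_derive x (smooth1_dilstep d').
    apply: is_derive_eqr (is_deriveD d1 (is_deriveZ (-1) d2)) _.
    by rewrite scaleN1r.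
  by rewrite (derive1_eq H).
have Psi0 (t : R) : ~~ (0 <= t <= d) -> Psi t = 0.
  rewrite /Psi negb_and -!ltNge => /orP[t0|t0].
    by rewrite !dilstep_le0 ?mulr0 ?addr0// ltW.
  by rewrite !dilstep_ge1 ?mulr1 ?subrr// ltW// (le_lt_trans dd').
have Psi1 (t : R) : `|Psi t| <= 1.
  rewrite ler_norml /Psi.
  move: (dilstep_ge0 d t) (dilstep_ge0 d' t) (dilstep_le1 d t) (dilstep_le1 d' t).
  by move=> h1 h2 h3 h4; apply/andP; split; lra.
(* In each kernel the factor [Psi], bounded by 1 on [0, d], has mass at most [d], and each of the
   two mollifiers has mass at most [S]; hence [S * S * d]. *)
pose s0 := fun l : 'I_3 => if l == i30 then Psi else mollif d.
pose s1 := fun l : 'I_3 => if l == i30 then mollif d' else if l == i31 then Psi else mollif d.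
pose s2 := fun l : 'I_3 => if l == i32 then Psi else mollif d'.
have sm (e : R) : smooth1 (mollif e) by exact: smooth1_mollif.
have md (t : R) : ~~ (0 <= t <= d) -> mollif d t = 0 by exact: (@smooth_supp_eta d d i30).
have md' (t : R) : ~~ (0 <= t <= d) -> mollif d' t = 0 by exact: (@smooth_supp_eta d' d i30).
(* For the mass, the height [S / d'] must be paired with the true width [d']; the width [d] of [md']
   would leave an unbounded factor [d / d']. *)
have md'' (t : R) : ~~ (0 <= t <= d') -> mollif d' t = 0 by exact: (@smooth_supp_eta d' d' i30).
have a0 : smooth_supp d s0.
  by split=> l; [|move=> t]; rewrite /s0; case: ifP => _ //; [exact: Psi0|exact: md].
have a1 : smooth_supp d s1.
  split=> l; [|move=> t]; rewrite /s1; case: ifP => _ //; try case: ifP => _ //.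
  - exact: md'.
  - exact: Psi0.
  - exact: md.
have a2 : smooth_supp d s2.
  by split=> l; [|move=> t]; rewrite /s2; case: ifP => _ //; [exact: Psi0|exact: md'].
have Sd : S / d * d = S by rewrite divfK// gt_eqF.
have Sd' : S / d' * d' = S by rewrite divfK// gt_eqF.
have Sd0 : 0 <= S / d by rewrite divr_ge0// ltW.
have Sd'0 : 0 <= S / d' by rewrite divr_ge0// ltW.
have k0 x : J (fun z => `|ker s0 x z|) <= S * S * d.
  have -> : S * S * d = (1 * d) * (S / d * d) * (S / d * d) by rewrite Sd; ring.
  apply: (@Rintegral_norm_ker _ _ _ (fun l => if l == i30 then 1 else S / d) (fun=> d)) => //.
  - exact: smooth_supp_bmf a0.
  - by move=> l; case: ifP.
  - by move=> l t; rewrite /s0; case: ifP => _ //; exact: hS.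
  - by case: a0.
have k1 x : J (fun z => `|ker s1 x z|) <= S * S * d.
  have -> : S * S * d = (S / d' * d') * (1 * d) * (S / d * d) by rewrite Sd Sd'; ring.
  apply: (@Rintegral_norm_ker _ _ _
    (fun l => if l == i30 then S / d' else if l == i31 then 1 else S / d)
    (fun l => if l == i30 then d' else d)) => //.
  - by move=> l; case: ifP.
  - exact: smooth_supp_bmf a1.
  - by move=> l; case: ifP => // _; case: ifP.
  - by move=> l t; rewrite /s1; case: ifP => _; [exact: hS|case: ifP => _ //; exact: hS].
  - move=> l t; rewrite /s1; case: ifP => _; first exact: md''.
    by case: ifP => _; [exact: Psi0|exact: md].
have k2 x : J (fun z => `|ker s2 x z|) <= S * S * d.
  have -> : S * S * d = (S / d' * d') * (S / d' * d') * (1 * d) by rewrite Sd'; ring.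
  apply: (@Rintegral_norm_ker _ _ _
    (fun l => if l == i32 then 1 else S / d')
    (fun l => if l == i32 then d else d')) => //.
  - by move=> l; case: ifP.
  - exact: smooth_supp_bmf a2.
  - by move=> l; case: ifP.
  - by move=> l t; rewrite /s2; case: ifP => _ //; exact: hS.
  - by move=> l t; rewrite /s2; case: ifP => _; [exact: Psi0|exact: md''].
have be e l : 0 < e -> bmf (eta e l : mR -> R) by move=> e0; exact: bmf_mollif.
have E x z := @ker_telescope Psi d d' x z dPsi.
have bd k s : smooth_supp d s -> forall l, bmf (dtens k s l : mR -> R).
  by move=> ads l; apply: smooth_supp_bmf; exact: smooth_supp_dtens ads.
have EA k l : mollform (ker (eta d)) (gu k) (gv l) = mollform (ker (eta d')) (gu k) (gv l) +
   (mollform (ker (dtens i30 s0)) (gu k) (gv l) + (mollform (ker (dtens i31 s1)) (gu k) (gv l)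
   + mollform (ker (dtens i32 s2)) (gu k) (gv l))).
  by apply: mollform_sum => //; [move=> m; exact: be|exact: bd|exact: bd|exact: bd].
have h0 := hC _ _ _ _ _ _ _ _ i30 i j bu bgu bv bgv wu wv a0 d4 uM vM k0.
have h1 := hC _ _ _ _ _ _ _ _ i31 i j bu bgu bv bgv wu wv a1 d4 uM vM k1.
have h2 := hC _ _ _ _ _ _ _ _ i32 i j bu bgu bv bgv wu wv a2 d4 uM vM k2.
have -> : 3 * (C * (S * S)) * (M * M * d) = C * (M * M * (S * S * d)) +
   C * (M * M * (S * S * d)) + C * (M * M * (S * S * d)) by ring.
exact: (sub3_le (EA i j) (EA j i) h0 h1 h2).
Qed.

End Minors.

(** * Passage to the limit in the minors *)

Section Compensated.
Variable R : realType.
Local Notation mR := (measurableTypeR R).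
Local Notation X := (R * R * R)%type.
Local Notation mX := (mR * mR * mR)%type.
Local Notation J := (Rintegral (@leb3s R) (@cube R)).

Let mC := @measurable_cube R.
Let fC := @cube_lty R.

Lemma ler_norm_cvg (a c b : R) (b_ : nat -> R) : b_ @ \oo --> b ->
  (forall n, `|a - b_ n| <= c) -> `|a - b| <= c.
Proof.
move=> bc h; have : (fun n => `|a - b_ n|) @ \oo --> `|a - b|.
  by apply: cvg_norm; apply: cvgB => //; exact: cvg_cst.
by move=> /cvgr_to_le; apply; exact: nearW.
Qed.

Lemma cvg_scale_harmonic (c : R) : (fun n => c * n.+1%:R^-1) @ \oo --> (0 : R).
Proof.
rewrite -(mulr0 c); apply: cvgM; first exact: cvg_cst.
exact: cvg_harmonic.
Qed.

Lemma mollminor_cvg (d_ : nat -> R) gu gv i j : (forall n, 0 < d_ n) -> d_ @ \oo --> 0 ->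
  (forall i, bmf (gu i : mX -> R)) -> (forall i, bmf (gv i : mX -> R)) ->
  (fun n => mollminor (d_ n) gu gv i j) @ \oo -->
  J (fun x => phi x * (gu i x * gv j x - gu j x * gv i x)).
Proof.
move=> d0 dc bgu bgv; have bp := bmf_phi R.
have E : J (fun x => phi x * (gu i x * gv j x - gu j x * gv i x)) =
    J (fun x => phi x * gv j x * gu i x) - J (fun x => phi x * gv i x * gu j x).
  rewrite -bmf_RintegralB//; last 2 first.
  - by apply: bmfM => //; exact: bmfM.
  - by apply: bmfM => //; exact: bmfM.
  by apply: eq_Rintegral => x _; ring.
rewrite E /mollminor; apply: cvgB.
- by apply: approx_identity => //; exact: bmfM.
- by apply: approx_identity => //; exact: bmfM.
Qed.

(** Lets [d'] tend to 0 along d/(n+1) in [mollminor_le]. The constant is chosen before the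
    functions, so the estimate is uniform along a sequence. *)
Lemma mollminor_lim_le : exists2 C : R, 0 <= C &
  forall u gu v gv M d i j, bmf u -> (forall i, bmf (gu i)) ->
  bmf v -> (forall i, bmf (gv i)) -> wgrad u gu -> wgrad v gv ->
  0 < d -> d < 4^-1 ->
  (forall i x, `|gu i x| <= M) -> (forall i x, `|gv i x| <= M) ->
  `|mollminor d gu gv i j - J (fun x => phi x * (gu i x * gv j x - gu j x * gv i x))|
     <= C * (M * M * d).
Proof.
have [C C0 hC] := @mollminor_le R; exists C => //.
move=> u gu v gv M d i j bu bgu bv bgv wu wv d0 d4 uM vM.
have dn0 n : 0 < d * n.+1%:R^-1 by rewrite mulr_gt0// invr_gt0.
have H := @mollminor_cvg _ gu gv i j dn0 (@cvg_scale_harmonic d) bgu bgv.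
apply: (ler_norm_cvg H) => n.
apply: (hC _ _ _ _ _ _ _ _ _ bu bgu bv bgv) => //.
by rewrite ler_pdivrMr ?ltr0n// ler_peMr ?ler1n// ltW.
Qed.

Variable iB : mX -> R.
Hypotheses (biB : bmf iB) (phiB : forall x, iB x * phi x = phi x).

(** Gradients extended by zero converge weakly to a constant times [iB], the indicator of the ball
    in the application; hence their mollifications converge to that constant times [cB d]. *)
Definition cB (d : R) (x : mX) := J (fun z => ker (fun=> mollif d) x z * iB z).

Lemma bmf_cB d : 0 < d -> bmf (cB d).
Proof. by move=> d0; apply: bmf_conv => // _; exact: bmf_mollif. Qed.

Section WeakLimit.
Variables (gu_ gv_ : nat -> 'I_3 -> mX -> R) (M : R) (au av : 'I_3 -> R).
Hypotheses (bgu : forall n i, bmf (gu_ n i)) (bgv : forall n i, bmf (gv_ n i))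
  (uM : forall n i x, `|gu_ n i x| <= M) (vM : forall n i x, `|gv_ n i x| <= M)
  (wgu : forall i h, bmf h ->
    (fun n => J (fun x => gu_ n i x * h x)) @ \oo --> au i * J (fun x => iB x * h x))
  (wgv : forall i h, bmf h ->
    (fun n => J (fun x => gv_ n i x * h x)) @ \oo --> av i * J (fun x => iB x * h x)).

(** For fixed [d] and [x] the kernel is itself a bounded test function, so the mollified factor
    converges pointwise with a uniform bound, hence strongly. A strong limit times a weak limit
    passes to the limit. *)
Lemma mollform_weak d i j : 0 < d ->
  (fun n => mollform (ker (fun=> mollif d)) (gu_ n i) (gv_ n j)) @ \oo -->
  au i * av j * J (fun x => phi x * cB d x).
Proof.
move=> d0; have bp := bmf_phi R; have bc := bmf_cB d0.
have bm (k : 'I_3) : bmf ((fun=> mollif d) k : mR -> R) by exact: bmf_mollif.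
pose K n (x : mX) := J (fun z => ker (fun=> mollif d) x z * gu_ n i z).
have bK n : bmf (K n) by exact: bmf_conv.
have Kc x : (fun n => K n x) @ \oo --> au i * cB d x.
  have -> : cB d x = J (fun z => iB z * ker (fun=> mollif d) x z).
    by apply: eq_Rintegral => z _; exact: mulrC.
  have -> : (fun n => K n x) = fun n => J (fun z => gu_ n i z * ker (fun=> mollif d) x z).
    by apply/funext => n; apply: eq_Rintegral => z _; exact: mulrC.
  exact: (@wgu i _ (bmf_kerr x bm)).
have M0 : 0 <= M by exact: le_trans (uM 0%N i30 (0, 0, 0)).
have [N KN] : exists N, forall n x, `|K n x| <= N.
  have [_ [B hB]] := bmf_ker bm.
  exists (B * M * fine (@leb3s R (@cube R))) => n x; apply: bmf_Rintegral_bound => //.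
    by apply: bmfM => //; exact: (bmf_kerr x bm).
  by move=> z _; rewrite normrM; apply: ler_pM => //; exact: (hB (x, z)).
have [_ [N' cN]] := bc.
(* [b n] has the mollified factor replaced by its limit and converges weakly; [e n] bounds the
   replacement error and tends to 0 by domination. *)
pose b n := J (fun x => gv_ n j x * (phi x * (au i * cB d x))).
pose e n := J (fun x => M * (`|phi x| * `|K n x - au i * cB d x|)).
have bb n : bmf (fun x : mX => phi x * `|K n x - au i * cB d x|).
  by apply: bmfM => //; apply: bmf_norm; apply: bmfB => //; exact: bmfZ.
have be n : bmf (fun x : mX => M * (`|phi x| * `|K n x - au i * cB d x|)).
  apply: bmfZ; apply: bmfM; first exact: bmf_norm.
  by apply: bmf_norm; apply: bmfB => //; exact: bmfZ.
have bcv : b @ \oo --> au i * av j * J (fun x => phi x * cB d x).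
  have := @wgv j _ (bmfM bp (bmfZ (au i) bc)).
  rewrite (_ : av j * _ = au i * av j * J (fun x => phi x * cB d x))//.
  rewrite [RHS](_ : _ = av j * (au i * J (fun x => phi x * cB d x))); last ring.
  rewrite -(bmf_RintegralZ mC fC (au i) (bmfM bp bc)).
  by congr (_ * _); apply: eq_Rintegral => x _; rewrite mulrA phiB; ring.
have ec : e @ \oo --> (0 : R).
  rewrite (_ : 0 = J (fun=> 0)); last by rewrite Rintegral_cst// mul0r.
  have [_ [P hP]] := bp.
  apply: (@bmf_dominated _ _ _ _ _ mC fC _ _ (M * (P * (N + `|au i| * N')))) => //.
  - exact: bmf_cst.
  - move=> n x _; rewrite normrM (ger0_norm M0); apply: ler_wpM2l => //.
    rewrite normrM !normr_id; apply: ler_pM => //.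
    apply: le_trans (ler_normB _ _) _; apply: lerD => //.
    by rewrite normrM ler_wpM2l.
  - move=> x _; rewrite -(mulr0 M); apply: cvgM; first exact: cvg_cst.
    rewrite -(mulr0 `|phi x|); apply: cvgM; first exact: cvg_cst.
    rewrite -(normr0 R) -(subrr (au i * cB d x)); apply: cvg_norm.
    by apply: cvgB => //; exact: cvg_cst.
have h n : `|mollform (ker (fun=> mollif d)) (gu_ n i) (gv_ n j) - b n| <= e n.
  rewrite /mollform /b -bmf_RintegralB//; last 2 first.
  - by apply: bmfM; [exact: bmfM|exact: bK].
  - by apply: bmfM => //; apply: bmfM => //; exact: bmfZ.
  apply: bmf_le_normr_Rintegral => //.
    apply: bmfB; first by apply: bmfM; [exact: bmfM|exact: bK].
    by apply: bmfM => //; apply: bmfM => //; exact: bmfZ.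
  move=> x _; rewrite -/(K n x).
  rewrite (_ : _ - _ = gv_ n j x * (phi x * (K n x - au i * cB d x))); last by rewrite /K; ring.
  by rewrite normrM ler_pM// normrM.
pose A n := mollform (ker (fun=> mollif d)) (gu_ n i) (gv_ n j).
rewrite -/A (_ : A = fun n => b n + (A n - b n)); last first.
  by apply/funext => n; rewrite addrC subrK.
rewrite -[X in _ --> X]addr0; apply: cvgD => //.
apply/cvgr0Pnorm_lt => eps eps0.
near=> n; apply: le_lt_trans (h n) _; near: n; exact: (cvgr_lt 0 ec).
Unshelve. all: by end_near. Qed.

End WeakLimit.

Lemma Rintegral_phi_gt0 : 0 < J (@phi R).
Proof.
rewrite Rintegral_tens; last exact: bmf_cut3.
have h : 0 < Rintegral (@lebesgue_measure R) (@side R) (@cutoff R).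
  pose I : set mR := `[- 8^-1, 8^-1]%classic.
  have mI : measurable I by exact: measurable_itv.
  have mS := @measurable_side R; have fS := @side_lty R.
  have IS : I `<=` @side R.
    by move=> x; rewrite /I /side/= !in_itv/= => /andP[h1 h2]; apply/andP; split; lra.
  apply: (@lt_le_trans _ _ (Rintegral (@lebesgue_measure R) (@side R) (\1_I))).
    have lI : @lebesgue_measure R I = (4^-1)%:E.
      rewrite /I lebesgue_measure_itv/= lte_fin ifT; last lra.
      by rewrite -EFinB; congr _%:E; lra.
    by rewrite /Rintegral integral_indic// (setIidl IS) [X in fine X]lI /= invr_gt0.
  apply: bmf_le_Rintegral => //.
  - exact: bmf_indic.
  - exact: (bmf_cut3 R i30).
  - move=> x _; rewrite indicE /I mem_setE in_itv/= -ler_norml.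
    have [hx|hx] := boolP (`|x| <= 8^-1); last exact: cutoff_ge0.
    by rewrite cutoff_eq1.
by rewrite !mulr_gt0.
Qed.

(** At fixed [d], letting [n] grow compares [m] with the minor of the limits up to O(d). As [d]
    tends to 0 the weight [cB d] becomes [iB], which is 1 where [phi] is nonzero, and the positive
    integral of [phi] is divided out. *)
Lemma minors_weak_limit (u_ v_ : nat -> mX -> R) (gu_ gv_ : nat -> 'I_3 -> mX -> R)
    (M m : R) (au av : 'I_3 -> R) i j :
  (forall n, bmf (u_ n)) -> (forall n, bmf (v_ n)) ->
  (forall n i, bmf (gu_ n i)) -> (forall n i, bmf (gv_ n i)) ->
  (forall n, wgrad (u_ n) (gu_ n)) -> (forall n, wgrad (v_ n) (gv_ n)) ->
  (forall n i x, `|gu_ n i x| <= M) -> (forall n i x, `|gv_ n i x| <= M) ->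
  (forall i h, bmf h ->
    (fun n => J (fun x => gu_ n i x * h x)) @ \oo --> au i * J (fun x => iB x * h x)) ->
  (forall i h, bmf h ->
    (fun n => J (fun x => gv_ n i x * h x)) @ \oo --> av i * J (fun x => iB x * h x)) ->
  (fun n => J (fun x => phi x * (gu_ n i x * gv_ n j x - gu_ n j x * gv_ n i x))) @ \oo
    --> m * J (@phi R) ->
  m = au i * av j - au j * av i.
Proof.
move=> bu bv bgu bgv wu wv uM vM wgu wgv wm.
have [C C0 hC] := mollminor_lim_le.
pose q := au i * av j - au j * av i.
have h1 d : 0 < d -> d < 4^-1 ->
    `|q * J (fun x => phi x * cB d x) - m * J (@phi R)| <= C * (M * M * d).
  move=> d0 d4.
  have cA : (fun n => mollminor d (gu_ n) (gv_ n) i j) @ \oo --> q * J (fun x => phi x * cB d x).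
    rewrite /q mulrBl; apply: cvgB; first exact: mollform_weak.
    by rewrite (mulrC (au j)) [av i * _]mulrC; exact: mollform_weak.
  have cD : (fun n => `|mollminor d (gu_ n) (gv_ n) i j -
      J (fun x => phi x * (gu_ n i x * gv_ n j x - gu_ n j x * gv_ n i x))|) @ \oo -->
      `|q * J (fun x => phi x * cB d x) - m * J (@phi R)|.
    by apply: cvg_norm; exact: cvgB.
  move: cD => /cvgr_to_le; apply; apply: nearW => n.
  exact: (hC _ _ _ _ _ _ _ _ (bu n) _ (bv n)).
pose d_ n : R := 8^-1 * n.+1%:R^-1.
have d_0 n : 0 < d_ n by rewrite /d_ mulr_gt0// invr_gt0.
have d_4 n : d_ n < 4^-1.
  apply: (@le_lt_trans _ _ 8^-1); last lra.
  by rewrite /d_ ler_pdivrMr ?ltr0n// ler_peMr ?ler1n// invr_ge0.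
have cd : d_ @ \oo --> (0 : R) by exact: cvg_scale_harmonic.
have cphi : (fun n => J (fun x => phi x * cB (d_ n) x)) @ \oo --> J (@phi R).
  have := approx_identity d_0 cd biB (bmf_phi R).
  rewrite (_ : J (fun x => phi x * iB x) = J (@phi R))//.
  by apply: eq_Rintegral => x _; rewrite mulrC phiB.
have : `|q * J (@phi R) - m * J (@phi R)| <= 0.
  have c1 : (fun n => `|q * J (fun x => phi x * cB (d_ n) x) - m * J (@phi R)|) @ \oo -->
     `|q * J (@phi R) - m * J (@phi R)|.
    apply: cvg_norm; apply: cvgB; last exact: cvg_cst.
    by apply: cvgM => //; exact: cvg_cst.
  have c2 : (fun n => C * (M * M * d_ n)) @ \oo --> (0 : R).
    rewrite -(mulr0 C); apply: cvgM; first exact: cvg_cst.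
    by rewrite -(mulr0 (M * M)); apply: cvgM => //; exact: cvg_cst.
  by apply: (ler_cvg_to c1 c2); apply: nearW => n; exact: h1.
rewrite normr_le0 -mulrBl mulf_eq0 (gt_eqF Rintegral_phi_gt0) orbF subr_eq0.
by move=> /eqP.
Qed.

End Compensated.

(** * Minors of gradient Young measures *)

Section YoungMinors.
Variable R : realType.
Local Notation mR := (measurableTypeR R).
Local Notation X := (R * R * R)%type.
Local Notation mX := (mR * mR * mR)%type.
Local Notation J := (Rintegral (@leb3s R) (@cube R)).
Local Notation B3 := (@B3 R : set mX).

Let mC := @measurable_cube R.
Let fC := @cube_lty R.

Lemma measurable_borel_continuous (T : ptopologicalType) (f : T -> R) :
  continuous f -> measurable_fun setT (f : borel T -> mR).
Proof.
move=> cf; apply: (measurability _ (RGenOpens.measurableE R)).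
move=> _ [_ [a [b ->] <-]]; rewrite setTI; apply: sub_sigma_algebra.
by move/continuousP: cf; apply; exact: interval_open.
Qed.

Lemma norm_entry_le m n (A : 'M[R]_(m.+1, n.+1)) i j : `|A i j| <= `|A|.
Proof.
rewrite -[leRHS]/(mx_norm A) mx_normrE.
exact: (le_bigmax _ (fun k => `|A k.1 k.2|) (i, j)).
Qed.

Lemma measurable_B3 : measurable B3.
Proof.
have -> : B3 = (fun x : mX => x.1.1 ^+ 2 + x.1.2 ^+ 2 + x.2 ^+ 2) @^-1` `]-oo, 1[%classic.
  by apply/seteqP; split => x; rewrite /Defs.B3 /= in_itv.
rewrite -[X in measurable X]setTI; apply: (_ : measurable_fun setT _) => //.
  apply: measurable_funD; first apply: measurable_funD; apply: measurable_funX.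
  - exact: measurable_fst2.
  - exact: measurable_snd2.
  - exact: measurable_snd.
Qed.

Lemma B3_cube : B3 `<=` @cube R.
Proof.
move=> x; rewrite /Defs.B3/= => x1.
have h (t : R) : t ^+ 2 < 1 -> side t.
  move=> t1; rewrite /side/= in_itv/= -ltr_norml.
  by rewrite -(@ltr_pXn2r _ 2) ?nnegrE// expr1n real_normK ?num_real.
have := sqr_ge0 x.1.1; have := sqr_ge0 x.1.2; have := sqr_ge0 x.2 => h1 h2 h3.
by split; [split|]; apply: h; lra.
Qed.

(* Turns the almost everywhere bounds on B3 into bounds valid everywhere. *)
Definition clampB (M : R) (h : mX -> R) : mX -> R :=
  (fun x => Num.max (- M) (Num.min M (h x))) \_ B3.

Lemma clampB_out M h x : ~ B3 x -> clampB M h x = 0.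
Proof. by move=> nx; rewrite /clampB patchE memNset. Qed.

Lemma clampB_le M h x : 0 <= M -> `|clampB M h x| <= M.
Proof.
move=> M0; rewrite /clampB patchE; case: ifP => _; last by rewrite normr0.
rewrite ler_norml; apply/andP; split; first by rewrite le_max lexx.
rewrite ge_max ge_min lexx andbT.
by rewrite ge0_cp.
Qed.

Lemma clampB_eq M h x : B3 x -> `|h x| <= M -> clampB M h x = h x.
Proof.
move=> Bx; rewrite ler_norml => /andP[h1 h2].
by rewrite /clampB patchE mem_set// (min_idPr h2) (max_idPr h1).
Qed.

Lemma bmf_clampB M h : 0 <= M -> measurable_fun B3 h -> bmf (clampB M h).
Proof.
move=> M0 mh; split; last by exists M => x; exact: clampB_le.
apply/(measurable_restrictT _ measurable_B3).
apply: measurable_maxr; first exact: measurable_cst.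
by apply: measurable_minr => //; exact: measurable_cst.
Qed.

(** Passes between the ball, with its almost everywhere statements, and the cube, where clamped
    representatives are bounded everywhere. *)
Lemma Rintegral_cubeE (F1 F2 : mX -> R) : bmf F1 -> measurable_fun B3 F2 ->
  (forall x, ~ B3 x -> F1 x = 0) ->
  {ae @leb3s R, forall x, B3 x -> F1 x = F2 x} ->
  J F1 = Rintegral (@leb3 R) B3 F2.
Proof.
move=> b1 m2 out ae12; have mB := measurable_B3.
have -> : J F1 = Rintegral (@leb3s R) B3 F1.
  rewrite Rintegral_mkcond [RHS]Rintegral_mkcond; congr Rintegral.
  apply/funext => x; rewrite !patchE.
  case: ifPn => xC; case: ifPn => xB //.
    by apply: out => Bx; rewrite mem_set in xB.
  by move/set_mem: xB => /B3_cube xc; rewrite mem_set in xC.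
rewrite leb3E /Rintegral; congr fine; apply: ae_eq_integral => //.
- by apply/measurable_EFinP; apply: measurable_funTS; case: b1.
- exact/measurable_EFinP.
- by apply: filterS ae12 => x h Bx; rewrite h.
Qed.

Lemma B3_lty : (@leb3s R B3 < +oo)%E.
Proof.
apply: le_lt_trans fC; apply: le_measure; rewrite ?inE//; first exact: measurable_B3.
exact: B3_cube.
Qed.

Lemma phi_out x : ~ B3 x -> phi x = 0.
Proof.
move=> nB; have [x4|[k xk]] := phi_supp x; last exact: phi_eq0 xk.
case: nB; rewrite /Defs.B3/=.
have h (t : R) : `|t| <= 4^-1 -> t ^+ 2 <= 16^-1.
  move=> t4; rewrite -(real_normK (num_real t)).
  have : `|t| ^+ 2 <= 4^-1 ^+ 2 by rewrite lerXn2r// nnegrE.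
  by lra.
have := h _ (x4 i30); have := h _ (x4 i31); have := h _ (x4 i32).
rewrite /crd/=; lra.
Qed.

Section Young.
Variables (mu : probability (borel 'M[R]_3) R).
Variables (y : nat -> X -> 'cV[R]_3) (G : nat -> X -> 'M[R]_3) (M : R).
Hypothesis yG : forall k, W1oo_le M (y k) (G k).
Hypothesis cvf : forall f : 'M[R]_3 -> R, continuous f ->
  mu.-integrable setT (EFin \o f) /\
  forall g : X -> R, (@leb3 R).-integrable (Defs.B3 (R := R)) (EFin \o g) ->
    (fun k => \int[@leb3 R]_(x in Defs.B3 (R := R)) (f (G k x) * g x))%R @ \oo -->
    ((\int[mu]_A f A) * \int[@leb3 R]_(x in Defs.B3 (R := R)) g x)%R.

(** No sign of [M] is assumed, while a clamping level must be nonnegative. *)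
Let M' := `|M|.
Let M'0 : 0 <= M'. Proof. exact: normr_ge0. Qed.

Let u (p : 'I_3) k : mX -> R := clampB M' (fun x => y k x p ord0).
Let g (p : 'I_3) k (i : 'I_3) : mX -> R := clampB M' (fun x => G k x p i).

Let my k p : measurable_fun B3 (fun x : mX => y k x p ord0).
Proof.
have [m1 _ _ _ _] := yG k.
have mc : measurable_fun setT ((fun A : 'cV[R]_3 => A p ord0) : borel 'cV[R]_3 -> mR).
  by apply: measurable_borel_continuous; exact: coord_continuous.
exact: measurableT_comp mc m1.
Qed.

Let mG k (f : 'M[R]_3 -> R) : continuous f -> measurable_fun B3 (fun x : mX => f (G k x)).
Proof.
have [_ m1 _ _ _] := yG k => cf.
exact: measurableT_comp (measurable_borel_continuous cf) m1.
Qed.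

Let centry (p i : 'I_3) : continuous (fun A : 'M[R]_3 => A p i).
Proof. exact: coord_continuous. Qed.

Let bu p k : bmf (u p k). Proof. exact: bmf_clampB. Qed.

Let bg p k i : bmf (g p k i).
Proof. by apply: bmf_clampB => //; exact: (mG k (@centry p i)). Qed.

Let ae_u p k : {ae @leb3s R, forall x, B3 x -> u p k x = y k x p ord0}.
Proof.
have [_ _ _ h _] := yG k.
have h' : {ae @leb3s R, forall x, B3 x -> `|y k x| <= M} := h.
apply: filterS h' => x {}h Bx.
apply: clampB_eq => //; apply: le_trans (norm_entry_le _ _ _) _.
by apply: le_trans (h Bx) _; exact: ler_norm.
Qed.

Let ae_g p k i : {ae @leb3s R, forall x, B3 x -> g p k i x = G k x p i}.
Proof.
have [_ _ _ _ h] := yG k.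
have h' : {ae @leb3s R, forall x, B3 x -> `|G k x| <= M} := h.
apply: filterS h' => x {}h Bx.
apply: clampB_eq => //; apply: le_trans (norm_entry_le _ _ _) _.
by apply: le_trans (h Bx) _; exact: ler_norm.
Qed.

Let wg p k : wgrad (u p k) (g p k).
Proof.
move=> a sa a0 j.
have btens (b : 'I_3 -> R -> R) : (forall i, smooth1 (b i)) ->
    measurable_fun setT (tens b : mX -> R).
  move=> sb; have mb i : measurable_fun setT (b i : mR -> mR).
    by apply: continuous_measurable_fun; exact: smooth1_continuous.
  apply: measurable_funM; first apply: measurable_funM.
  - exact: (measurableT_comp (mb i30) (@measurable_fst2 R)).
  - exact: (measurableT_comp (mb i31) (@measurable_snd2 R)).
  - exact: (measurableT_comp (mb i32) measurable_snd).
have ba i : bmf (a i : mR -> R).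
  apply: (@continuous_bmf_itv _ _ (- 2^-1) 2^-1); first exact: smooth1_continuous.
  by move=> t; rewrite -ler_norml -ltNge => /ltW; exact: a0.
have bda i : bmf (dtens j a i : mR -> R).
  apply: (@continuous_bmf_itv _ _ (- 2^-1) 2^-1).
    by apply: smooth1_continuous; exact: smooth1_dtens.
  move=> t; rewrite -ler_norml -ltNge => t2; rewrite /dtens; case: ifP => _.
    exact: derive1_outnorm (a0 i) t2.
  by apply: a0; exact: ltW.
have [_ _ w _ _] := yG k.
have := w _ (test_function_tens sa a0) p j; rewrite (pderiv_tens j sa) => E.
have E1 : J (fun x => u p k x * tens (dtens j a) x) =
    Rintegral (@leb3 R) B3 (fun x => y k x p ord0 * tens (dtens j a) x).
  apply: Rintegral_cubeE.
  - by apply: bmfM; [exact: bu|exact: bmf_tens].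
  - apply: measurable_funM; first exact: my.
    by apply: measurable_funTS; apply: btens; exact: smooth1_dtens.
  - by move=> x nx; rewrite /u clampB_out// mul0r.
  - by apply: filterS (ae_u p k) => x h Bx; rewrite h.
have E2 : J (fun x => g p k j x * tens a x) =
    Rintegral (@leb3 R) B3 (fun x => G k x p j * tens a x).
  apply: Rintegral_cubeE.
  - by apply: bmfM; [exact: bg|exact: bmf_tens].
  - apply: measurable_funM; first exact: (mG k (@centry p j)).
    by apply: measurable_funTS; exact: btens.
  - by move=> x nx; rewrite /g clampB_out// mul0r.
  - by apply: filterS (ae_g p k j) => x h Bx; rewrite h.
exact: etrans E1 (etrans E (congr1 -%R (esym E2))).
Qed.

Let integrableB (h : mX -> R) : bmf h -> (@leb3 R).-integrable B3 (EFin \o h).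
Proof. by move=> bh; exact: (bmf_integrable measurable_B3 B3_lty bh). Qed.

(** The Young measure convergence for the continuous function [A |-> A p i], transferred to the
    cube. *)
Let wcvg p i (h : mX -> R) : bmf h ->
  (fun k => J (fun x => g p k i x * h x)) @ \oo -->
  barycenter mu p i * J (fun x => \1_B3 x * h x).
Proof.
move=> bh; have [_ /(_ h (integrableB bh))] := cvf (@centry p i).
have -> : J (fun x => \1_B3 x * h x) = Rintegral (@leb3 R) B3 h.
  apply: Rintegral_cubeE.
  - by apply: bmfM => //; apply: bmf_indic; exact: measurable_B3.
  - by apply: measurable_funTS; case: bh.
  - by move=> x nx; rewrite indicE memNset// mul0r.
  - by apply: aeW => x Bx; rewrite indicE mem_set// mul1r.
rewrite /barycenter mxE => H.
suff K : (fun k => Rintegral (@leb3 R) B3 (fun x => G k x p i * h x)) =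
    (fun k => J (fun x => g p k i x * h x)) by rewrite -K.
apply/funext => k; apply/esym/Rintegral_cubeE.
- exact: bmfM.
- by apply: measurable_funM; [exact: (mG k (@centry p i))|apply: measurable_funTS; case: bh].
- by move=> x nx; rewrite /g clampB_out// mul0r.
- by apply: filterS (ae_g p k i) => x h1 Bx; rewrite h1.
Qed.

Lemma continuous_minor (p p' i j : 'I_3) :
  continuous (fun A : 'M[R]_3 => A p i * A p' j - A p j * A p' i).
Proof.
have c (q k : 'I_3) (A : 'M[R]_3) : {for A, continuous (fun A : 'M[R]_3 => A q k)}.
  exact: (@centry q k A).
move=> A; apply: (cvgB (cvgM (c p i A) (c p' j A)) (cvgM (c p j A) (c p' i A))).
Qed.

(** The Young measure convergence for the minor, tested with [phi], supplies the limit that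
    [minors_weak_limit] identifies from the weak limits of the entries. *)
Lemma Rintegral_young_minor (p p' i j : 'I_3) :
  \int[mu]_A (A p i * A p' j - A p j * A p' i) =
  barycenter mu p i * barycenter mu p' j - barycenter mu p j * barycenter mu p' i.
Proof.
have cm := @continuous_minor p p' i j.
apply: (@minors_weak_limit R (\1_B3) _ _ (u p) (u p') (g p) (g p') M' _
  (barycenter mu p) (barycenter mu p') i j) => //.
- by apply: bmf_indic; exact: measurable_B3.
- move=> x; rewrite indicE; have [xB|xB] := pselect (B3 x); first by rewrite mem_set// mul1r.
  by rewrite phi_out// mulr0.
- by move=> n k x; exact: clampB_le.
- by move=> n k x; exact: clampB_le.
- by move=> k h bh; exact: wcvg.
- by move=> k h bh; exact: wcvg.
have [_ /(_ (@phi R) (integrableB (bmf_phi R)))] := cvf cm.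
have -> : Rintegral (@leb3 R) B3 (@phi R) = J (@phi R).
  symmetry; apply: Rintegral_cubeE.
  - exact: bmf_phi.
  - by apply: measurable_funTS; case: (bmf_phi R).
  - exact: phi_out.
  - exact: aeW.
move=> H.
suff K : (fun k => Rintegral (@leb3 R) B3 (fun x =>
      (G k x p i * G k x p' j - G k x p j * G k x p' i) * phi x)) =
    (fun k => J (fun x => phi x * (g p k i x * g p' k j x - g p k j x * g p' k i x))).
  by rewrite -K.
apply/funext => k; apply/esym/Rintegral_cubeE.
- by apply: bmfM; [exact: bmf_phi|apply: bmfB; exact: bmfM].
- by apply: measurable_funM; [exact: (mG k cm)|apply: measurable_funTS; case: (bmf_phi R)].
- by move=> x nx; rewrite phi_out// mul0r.
- apply: filterS2 (filterI (ae_g p k i) (ae_g p k j)) (filterI (ae_g p' k i) (ae_g p' k j)) => x.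
  by move=> [h1 h2] [h3 h4] Bx; rewrite h1// h2// h3// h4// mulrC.
Qed.

End Young.

End YoungMinors.

(** * Linear algebra of the wells *)

Section Algebra.
Variable R : realType.
Implicit Types (A Q U X Y L : 'M[R]_3).

(** The cofactor matrix is the transposed adjugate. *)
Definition subcof A : 'M[R]_3 := A - (\adj A)^T.

Definition fip X Y : R := \tr (X^T *m Y).

Lemma fipE X Y : fip X Y = \sum_i \sum_j X i j * Y i j.
Proof.
rewrite /fip /mxtrace exchange_big; apply: eq_bigr => j _.
by rewrite mxE; apply: eq_bigr => i _; rewrite mxE.
Qed.

Lemma fip_ge0 X : 0 <= fip X X.
Proof. by rewrite fipE; do 2 (apply: sumr_ge0 => ? _); rewrite -expr2 sqr_ge0. Qed.

Lemma fip_gt0 X : X != 0 -> 0 < fip X X.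
Proof.
move=> X0; rewrite lt_neqAle fip_ge0 andbT eq_sym; apply: contra X0 => /eqP.
rewrite fipE => /eqP; rewrite psumr_eq0; last first.
  by move=> i _; apply: sumr_ge0 => j _; rewrite -expr2 sqr_ge0.
move=> /allP h; apply/eqP/matrixP => i j; rewrite mxE.
have := h i (mem_index_enum i); rewrite /= psumr_eq0; last first.
  by move=> k _; rewrite -expr2 sqr_ge0.
by move=> /allP/(_ j (mem_index_enum j)); rewrite /= mulf_eq0 orbb => /eqP.
Qed.

(** Cauchy-Schwarz for vectors of equal norm, read off from |X - L|^2 >= 0. *)
Lemma fip_le X L : fip X X = fip L L -> fip X L <= fip L L.
Proof.
move=> XL; have := fip_ge0 (X - L).
have -> : fip (X - L) (X - L) = fip X X - fip X L - fip X L + fip L L.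
  rewrite !fipE -!sumrB -big_split; apply: eq_bigr => i _.
  rewrite -!sumrB -big_split; apply: eq_bigr => j _ /=.
  by rewrite !mxE; ring.
rewrite XL; lra.
Qed.

Lemma fip_rotl Q X : Q^T *m Q = 1%:M -> fip (Q *m X) (Q *m X) = fip X X.
Proof. by move=> QQ; rewrite /fip trmx_mul -mulmxA (mulmxA Q^T) QQ mul1mx. Qed.

Lemma fip_rotr Q X : Q^T *m Q = 1%:M -> fip (X *m Q) (X *m Q) = fip X X.
Proof.
move=> /mulmx1C QQ.
by rewrite /fip trmx_mul -mulmxA mxtrace_mulC -!mulmxA QQ mulmx1.
Qed.

(** Characterises the adjugate of an invertible matrix, so that its behaviour under rotations is
    checked by one multiplication instead of by expanding cofactors. *)
Lemma adj_mul_unit A B : A \in unitmx -> A *m B = (\det A)%:M -> \adj A = B.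
Proof. by move=> uA AB; apply: (can_inj (mulKmx uA)); rewrite mul_mx_adj AB. Qed.

Lemma subcof_rotl Q U : SO3 Q -> U \in unitmx -> subcof (Q *m U) = Q *m subcof U.
Proof.
move=> [QQ dQ] uU.
have uQ : Q \in unitmx by rewrite unitmxE dQ unitr1.
rewrite /subcof mulmxBr; congr (_ - _).
rewrite (@adj_mul_unit _ (\adj U *m Q^T)).
- by rewrite trmx_mul trmxK.
- by rewrite unitmx_mul uQ.
- rewrite -mulmxA (mulmxA U) mul_mx_adj det_mulmx dQ mul1r.
  by rewrite mul_scalar_mx -scalemxAr (mulmx1C QQ) scalemx1.
Qed.

Lemma subcof_rotr Q U : SO3 Q -> U \in unitmx -> subcof (U *m Q) = subcof U *m Q.
Proof.
move=> [QQ dQ] uU.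
have uQ : Q \in unitmx by rewrite unitmxE dQ unitr1.
rewrite /subcof mulmxBl; congr (_ - _).
rewrite (@adj_mul_unit _ (Q^T *m \adj U)).
- by rewrite trmx_mul trmxK.
- by rewrite unitmx_mul uQ andbT.
- by rewrite -mulmxA (mulmxA Q) (mulmx1C QQ) mul1mx mul_mx_adj det_mulmx dQ mulr1.
Qed.

Lemma SO3_1 : SO3 (1%:M : 'M[R]_3).
Proof. by split; rewrite ?det1// trmx1 mulmx1. Qed.

Lemma SO3_tr Q : SO3 Q -> SO3 Q^T.
Proof. by move=> [QQ dQ]; split; rewrite ?det_tr// trmxK (mulmx1C QQ). Qed.

Lemma subcof_SO3 Q : SO3 Q -> subcof Q = 0.
Proof.
move=> SQ; have u1 : (1%:M : 'M[R]_3) \in unitmx by exact: unitmx1.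
by rewrite -[Q]mulmx1 subcof_rotl// /subcof adj1 trmx1 subrr mulmx0.
Qed.

Lemma posdef_unit U : posdef_sym U -> U \in unitmx.
Proof.
move=> [_ pU]; rewrite unitmxE unitfE; apply/negP => /det0P[v v0 vU].
have vT0 : v^T != 0 by rewrite trmx_eq0.
by have := pU _ vT0; rewrite trmxK vU mul0mx mxE ltxx.
Qed.

(** If U = cof U, symmetry gives U^2 = (det U) 1; determinants give (det U)^2 = (det U)^3, so det U
    = 1 and U^2 = 1. A nonzero column of U - 1 would then be an eigenvector for -1, against
    positivity. *)
Lemma subcof_posdef_neq0 U : posdef_sym U -> U <> 1%:M -> subcof U != 0.
Proof.
move=> pU U1; have uU := posdef_unit pU; have [sU qU] := pU; apply/negP => /eqP cU.
have aU : \adj U = U.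
  by apply: trmx_inj; rewrite sU; apply/esym/eqP; rewrite -subr_eq0; apply/eqP.
have UU : U *m U = (\det U)%:M by rewrite -{2}aU mul_mx_adj.
have d0 : \det U != 0 by rewrite -unitfE -unitmxE.
have dU : \det U = 1.
  have := congr1 determinant UU; rewrite det_mulmx det_scalar => E.
  have : \det U ^+ 2 * (\det U - 1) = 0.
    by rewrite mulrBr mulr1 -exprSr -E expr2 subrr.
  by move/eqP; rewrite mulf_eq0 expf_eq0 (negbTE d0) andbF/= subr_eq0 => /eqP.
apply: U1; apply/eqP; rewrite -subr_eq0; apply/negPn/negP => D0.
have UD : U *m (U - 1%:M) = - (U - 1%:M).
  by rewrite mulmxBr UU dU mulmx1 opprB.
have [j wj] : exists j, col j (U - 1%:M) != 0.
  apply/existsP; rewrite -negb_forall; apply: contra D0 => /forallP h.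
  apply/eqP/matrixP => i j; have /eqP/matrixP/(_ i ord0) := h j.
  by rewrite !mxE.
have := qU _ wj; set w := col j _.
have -> : w^T *m U *m w = - (w^T *m w).
  have Uw : U *m w = - w by rewrite /w colE mulmxA UD mulNmx.
  by rewrite -mulmxA Uw mulmxN.
rewrite mxE oppr_gt0 mxE; apply/negP; rewrite -leNgt.
by apply: sumr_ge0 => i _; rewrite mxE -expr2 sqr_ge0.
Qed.

Lemma det_mx2 (B : 'M[R]_2) :
  \det B = B ord0 ord0 * B ord_max ord_max - B ord0 ord_max * B ord_max ord0.
Proof.
have o1 : lift ord0 ord0 = ord_max :> 'I_2 by exact: val_inj.
have o2 : lift ord_max ord0 = ord0 :> 'I_2 by exact: val_inj.
rewrite (expand_det_row _ ord0) !big_ord_recl big_ord0 /cofactor !det_mx11 !mxE.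
by rewrite !o1 !o2 /= expr0 expr1; ring.
Qed.

Lemma cofactor3E A i j : cofactor A i j = (-1) ^+ (i + j) *
  (A (lift i ord0) (lift j ord0) * A (lift i ord_max) (lift j ord_max) -
   A (lift i ord0) (lift j ord_max) * A (lift i ord_max) (lift j ord0)).
Proof. by rewrite /cofactor det_mx2 !mxE. Qed.

End Algebra.

(** * Integration of the polyaffine lower bound *)

Section IntegralMonotone.
Context d (T : measurableType d) (R : realType) (mu : {measure set T -> \bar R}).

(* No measurability is needed: both parts of the integral are suprema over the
   simple functions below. *)
Lemma le_integral_pointwise (f g : T -> \bar R) : (forall x, (f x <= g x)%E) ->
  (\int[mu]_x f x <= \int[mu]_x g x)%E.
Proof.
move=> fg; rewrite /integral /= !patch_setT.
apply: leeB; apply: le_ereal_sup => _ [h hf <-]; exists h => // x;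
  apply: le_trans (hf x) _; rewrite ?funeposE ?funenegE.
- by rewrite ge_max !le_max fg lexx orbT.
- by rewrite ge_max !le_max leeN2 fg lexx orbT.
Qed.

Lemma integrable_Rintegral_sum (I : Type) (s : seq I) (F : I -> T -> R) :
  (forall i, mu.-integrable setT (EFin \o F i)) ->
  mu.-integrable setT (EFin \o (fun x => \sum_(i <- s) F i x)) /\
  Rintegral mu setT (fun x => \sum_(i <- s) F i x) =
  \sum_(i <- s) Rintegral mu setT (F i).
Proof.
move=> iF; elim: s => [|i s [IH1 IH2]].
  have -> : (fun x => \sum_(i <- [::]) F i x) = (fun=> 0).
    by apply/funext => x; rewrite big_nil.
  split; first exact: integrable0.
  by rewrite big_nil Rintegral_cst// mul0r.
have -> : (fun x => \sum_(j <- i :: s) F j x) = fun x => F i x + \sum_(j <- s) F j x.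
  by apply/funext => x; rewrite big_cons.
split; last by rewrite RintegralD// IH2 big_cons.
have := integrableD measurableT (iF i) IH1.
by congr (_.-integrable _ _).
Qed.

End IntegralMonotone.

Section Main.
Variables (R : realType) (mu : probability (borel 'M[R]_3) R).
Hypothesis muG : homogeneous_GYM mu.

Lemma integrable_continuous (f : 'M[R]_3 -> R) : continuous f ->
  mu.-integrable setT (EFin \o f).
Proof. by case: muG => y [G [_ cvf]] cf; have [] := cvf f cf. Qed.

Lemma GYM_Rintegral_minor (p p' i j : 'I_3) :
  \int[mu]_A ((A : 'M[R]_3) p i * (A : 'M[R]_3) p' j - (A : 'M[R]_3) p j * (A : 'M[R]_3) p' i) =
  barycenter mu p i * barycenter mu p' j - barycenter mu p j * barycenter mu p' i.
Proof. by case: muG => y [G [[M yG] cvf]]; exact: Rintegral_young_minor yG cvf p p' i j. Qed.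

(** The integrand is a linear combination of entries and signed 2x2 minors, each of which [mu]
    averages to its value at the barycenter. *)
Lemma GYM_Rintegral_subcof (L : 'M[R]_3) :
  mu.-integrable setT (EFin \o (fun A => fip (subcof A) L)) /\
  \int[mu]_A fip (subcof A) L = fip (subcof (barycenter mu)) L.
Proof.
pose mm (i j : 'I_3) (A : 'M[R]_3) :=
  A (lift i ord0) (lift j ord0) * A (lift i ord_max) (lift j ord_max) -
   A (lift i ord0) (lift j ord_max) * A (lift i ord_max) (lift j ord0).
pose F (k : 'I_3 * 'I_3) (A : 'M[R]_3) :=
  L k.1 k.2 * A k.1 k.2 - (L k.1 k.2 * (-1) ^+ (k.1 + k.2)) * mm k.1 k.2 A.
have i1 (i j : 'I_3) : mu.-integrable setT (EFin \o (fun A : 'M[R]_3 => A i j)).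
  by apply: integrable_continuous; exact: coord_continuous.
have i2 i j : mu.-integrable setT (EFin \o mm i j).
  by apply: integrable_continuous; exact: continuous_minor.
have iZ (c : R) (f : 'M[R]_3 -> R) : mu.-integrable setT (EFin \o f) ->
    mu.-integrable setT (EFin \o (fun A => c * f A)).
  by move=> h; have := integrableZl measurableT c h; congr (_.-integrable _ _).
have iF k : mu.-integrable setT (EFin \o F k).
  have := integrableB measurableT (iZ (L k.1 k.2) _ (i1 k.1 k.2))
     (iZ (L k.1 k.2 * (-1) ^+ (k.1 + k.2)) _ (i2 k.1 k.2)).
  by congr (_.-integrable _ _).
have FE A : fip (subcof A) L = \sum_(k <- index_enum ('I_3 * 'I_3)%type) F k A.
  rewrite fipE pair_big /=; apply: eq_bigr => -[i j] _ /=.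
  by rewrite /F /subcof !mxE cofactor3E /mm /=; ring.
have [h1 h2] := integrable_Rintegral_sum (index_enum ('I_3 * 'I_3)%type) iF.
have -> : (fun A => fip (subcof A) L) = fun A => \sum_(k <- index_enum ('I_3 * 'I_3)%type) F k A.
  by apply/funext => A; exact: FE.
split => //; rewrite h2 FE; apply: eq_bigr => k _.
rewrite /F RintegralB//; try exact: iZ.
rewrite !RintegralZl//; congr (_ * _ - _ * _); first by rewrite /barycenter mxE.
exact: GYM_Rintegral_minor.
Qed.

End Main.

Theorem lemma5p4 (R : realType) (n : nat) (U : 'I_n.+1 -> 'M[R]_3) (delta : R)
    (hdist : injective U)
    (hpos : forall i, posdef_sym (U i))
    (hne1 : forall i, U i <> 1%:M)
    (hsym : range U = [set Q^T *m U ord0 *m Q | Q in @P24 R])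
    (hdelta : 0 < delta) (s : 'I_n.+1) :
  quasiconvex_interior_at (Wnuc delta U) (U s).
Proof.
move=> mu muG bar.
pose L := subcof (U s); pose c := fip L L.
have uU i := posdef_unit (hpos i).
have L0 : L != 0 by exact: subcof_posdef_neq0 (hpos s) (hne1 s).
have c0 : 0 < c by exact: fip_gt0.
(* By [hsym], [U i] is a rotation conjugate of [U ord0]; [subcof] is conjugated along with it, and
   the Frobenius norm is invariant. *)
have nU i : fip (subcof (U i)) (subcof (U i)) = fip (subcof (U ord0)) (subcof (U ord0)).
  have : range U (U i) by exists i.
  rewrite hsym => -[Q [SQ _] <-]; have ST := SO3_tr SQ.
  rewrite subcof_rotr//; last first.
    by rewrite unitmx_mul uU andbT unitmx_tr unitmxE (proj2 SQ) unitr1.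
  rewrite fip_rotr ?(proj1 SQ)// subcof_rotl//.
  by rewrite fip_rotl ?(proj1 ST).
(* [Wnuc] tests [SO3] first, so [U s] must be excluded from it: there [subcof] would vanish,
   contradicting [L0]. *)
have Ws : Wnuc delta U (U s) = 0%E.
  rewrite /Wnuc ifN; last first.
    by apply/negP => /set_mem /subcof_SO3 E; rewrite /L E eqxx in L0.
  rewrite ifT//; apply/mem_set; exists s => //.
  by exists 1%:M; [exact: SO3_1|rewrite mul1mx].
(* A polyaffine function below [W] whose [mu]-mean is its value 0 at [U s]. *)
pose l (A : 'M[R]_3) : R := delta / c * (fip (subcof A) L - c).
(* On [SO3] equality holds, with value [- delta]; on the wells [subcof A] has the same norm as [L],
   so [fip_le] gives [l A <= 0]. *)
have lW A : ((l A)%:E <= Wnuc delta U A)%E.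
  rewrite /Wnuc /l; case: ifPn => [/set_mem SA|_].
    rewrite subcof_SO3// /fip trmx0 mul0mx mxtrace0 sub0r mulrN divfK ?gt_eqF//.
  case: ifPn => [/set_mem[i _ [Q SQ <-]]|_]; last exact: leey.
  rewrite lee_fin pmulr_rle0 ?divr_gt0// subr_le0 subcof_rotl//.
  by apply: fip_le; rewrite fip_rotl ?(proj1 SQ)// nU /L nU.
have [ih Eh] := GYM_Rintegral_subcof muG L.
have ic : mu.-integrable setT (EFin \o (fun _ : borel 'M[R]_3 => c)).
  by apply: finite_measure_integrable_cst.
have il0 : mu.-integrable setT (EFin \o (fun A => fip (subcof A) L - c)).
  have := integrableB measurableT ih ic.
  by congr (_.-integrable _ _).
have il : mu.-integrable setT (EFin \o l).
  have := integrableZl measurableT (delta / c) il0.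
  by congr (_.-integrable _ _).
have El : (\int[mu]_A (l A)%:E = 0)%E.
  have : Rintegral mu setT l = 0.
    have Ec : Rintegral mu setT (fun _ : borel 'M[R]_3 => c) = c.
      by rewrite Rintegral_cst// [X in fine X](@probability_setT _ _ _ mu) mulr1.
    by rewrite RintegralZl// RintegralB// Eh bar Ec -/c subrr mulr0.
  move=> l0; rewrite -[RHS]/(0%:E) -l0 /Rintegral fineK//.
  by apply: integrable_fin_num.
by rewrite Ws -El; exact: le_integral_pointwise.
Qed.
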